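(* Let $(S,\mathcal{A},\mu)$ be a complete, $\sigma$-finite measure space, $E$ a Köthe function space over $(S,\mathcal{A},\mu)$, and $X$ a real Banach space such that the simple functions are dense in $E(X)$. If $X$ is locally octahedral (resp. weakly octahedral), then $E(X)$ is locally octahedral (resp. weakly octahedral). In particular, if $p\in[1,\infty)$ and $X$ is locally octahedral (resp. weakly octahedral), then so is $L^p(\mu,X)$. Moreover, $L^\infty(\mu,X)$ is locally octahedral whenever $X$ is locally octahedral.
   Context: A real Banach space $X$ is locally octahedral (LOH) if for every $x\in X$ and $\varepsilon>0$ there is $y\in S_X$ with $\|sx+y\|\ge(1-\varepsilon)(|s|\|x\|+1)$ for all $s\in\mathbb{R}$. $X$ is weakly octahedral (WOH) if for every finite-dimensional subspace $F$ of $X$, every $x^*\in B_{X^*}$ and every $\varepsilon>0$ there is $y\in S_X$ with $\|x+y\|\ge(1-\varepsilon)(|x^*(x)|+1)$ for all $x\in F$. ($S_X$ unit sphere, $B_{X^*}$ dual unit ball.) Köthe function space over $(S,\mathcal{A},\mu)$: a Banach space $(E,\|\cdot\|_E)$ of real-valued measurable functions on $S$ (modulo a.e. equality) such that $\chi_A\in E$ whenever $\mu(A)<\infty$; every $f\in E$ is integrable over every set of finite measure; and if $g$ is measurable, $f\in E$ and $|g|\le|f|$ a.e., then $g\in E$ and $\|g\|_E\le\|f\|_E$. A function $f:S\to X$ is simple if it is constant on each of finitely many disjoint measurable sets of finite measure and zero outside their union; Bochner-measurable if it is an a.e. limit of simple functions. $E(X)$ is the space of Bochner-measurable $f:S\to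 X$ (modulo a.e.) with $\|f(\cdot)\|\in E$, normed by $\|f\|=\|\,\|f(\cdot)\|\,\|_E$. $L^p(\mu,X)$ denotes the Lebesgue–Bochner spaces. *)

(* Defs.v *)
From HB Require Import structures.
From mathcomp Require Import all_boot all_order all_algebra.
From mathcomp Require Import all_classical all_reals all_analysis.
Set Implicit Arguments. Unset Strict Implicit. Unset Printing Implicit Defensive.
Import Order.TTheory GRing.Theory Num.Theory.
Import numFieldNormedType.Exports.
Local Open Scope classical_set_scope.
Local Open Scope ring_scope.

Section Octahedral.
Context {R : realType} {V : lmodType R}.

(** Local octahedrality of the (semi)normed space (P, N): P is the carrier
    (a subspace of V), N its norm. *)
Definition LOH_on (P : set V) (N : V -> R) : Prop :=
  forall x, P x -> forall eps : R, 0 < eps ->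
    exists y, [/\ P y, N y = 1 &
      forall s : R, (1 - eps) * (`|s| * N x + 1) <= N (s *: x + y)].

Definition dual_ball (P : set V) (N : V -> R) (phi : V -> R) : Prop :=
  [/\ forall x y, P x -> P y -> phi (x + y) = phi x + phi y,
      forall (a : R) x, P x -> phi (a *: x) = a * phi x &
      forall x, P x -> `|phi x| <= N x].

(** Weak octahedrality; a finite-dimensional subspace F is the span of
    finitely many vectors u 0, ..., u (n-1) of P. *)
Definition WOH_on (P : set V) (N : V -> R) : Prop :=
  forall (n : nat) (u : 'I_n -> V), (forall i, P (u i)) ->
  forall phi : V -> R, dual_ball P N phi ->
  forall eps : R, 0 < eps ->
    exists y, [/\ P y, N y = 1 &
      forall c : 'I_n -> R,
        (1 - eps) * (`|phi (\sum_(i < n) c i *: u i)| + 1)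
          <= N (\sum_(i < n) c i *: u i + y)].
End Octahedral.

Definition LOH {R : realType} (X : normedModType R) : Prop :=
  LOH_on [set: X] (fun x : X => `|x|).
Definition WOH {R : realType} (X : normedModType R) : Prop :=
  WOH_on [set: X] (fun x : X => `|x|).

Section Bochner.
Context {R : realType} {d : measure_display} {T : measurableType d}.
Variable mu : {measure set T -> \bar R}.

Definition simple_fun {X : normedModType R} (f : T -> X) : Prop :=
  exists (n : nat) (A : 'I_n -> set T) (x : 'I_n -> X),
    [/\ forall i, measurable (A i) /\ (mu (A i) < +oo)%E,
        forall i j, i != j -> A i `&` A j = set0 &
        f = (fun s => \sum_(i < n) (\1_(A i) s : R) *: x i)].

Definition bochner_measurable {X : normedModType R} (f : T -> X) : Prop :=
  exists g : nat -> T -> X, (forall n, simple_fun (g n)) /\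
    {ae mu, forall s, (fun n => g n s) @ \oo --> f s}.

(** (E, nE) is a Köthe function space over (T, mu). Elements of E are
    real functions; equality is a.e. (nE vanishes exactly on a.e.-null
    functions and, by the ideal property, E and nE are a.e.-invariant). *)
Record is_Kothe (E : set (T -> R)) (nE : (T -> R) -> R) : Prop := {
  Kothe_meas : forall f, E f -> measurable_fun setT f;
  Kothe_add : forall f g, E f -> E g -> E (f \+ g);
  Kothe_scale : forall (a : R) f, E f -> E (fun s => a * f s);
  Kothe_triangle : forall f g, E f -> E g -> nE (f \+ g) <= nE f + nE g;
  Kothe_homog : forall (a : R) f, E f -> nE (fun s => a * f s) = `|a| * nE f;
  Kothe_def : forall f, E f -> (nE f = 0 <-> f = (fun _ => 0) %[ae mu]);
  Kothe_complete : forall u : nat -> T -> R, (forall n, E (u n)) ->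
    (forall e : R, 0 < e -> exists N : nat, forall m n, (N <= m)%N -> (N <= n)%N ->
        nE (u m \- u n) < e) ->
    exists f, E f /\ (fun n => nE (u n \- f)) @ \oo --> (0 : R);
  Kothe_indic : forall A, measurable A -> (mu A < +oo)%E -> E (\1_A : T -> R);
  Kothe_integrable : forall f, E f -> forall A, measurable A -> (mu A < +oo)%E ->
    mu.-integrable A (EFin \o f);
  Kothe_ideal : forall f (g : T -> R), E f -> measurable_fun setT g ->
    {ae mu, forall s, `|g s| <= `|f s|} -> E g /\ nE g <= nE f }.

Definition EX {X : normedModType R} (E : set (T -> R)) : set (T -> X) :=
  fun f => bochner_measurable f /\ E (fun s => `|f s|).
Definition nEX {X : normedModType R} (nE : (T -> R) -> R) (f : T -> X) : R :=
  nE (fun s => `|f s|).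

Definition simple_dense (X : normedModType R) (E : set (T -> R))
    (nE : (T -> R) -> R) : Prop :=
  forall f : T -> X, EX E f -> forall eps : R, 0 < eps ->
    exists g, simple_fun g /\ nEX nE (f \- g) < eps.

Definition LpX {X : normedModType R} (p : \bar R) : set (T -> X) :=
  fun f => bochner_measurable f /\ (Lnorm mu p (fun s => (`|f s|)%:E) < +oo)%E.
Definition LpnX {X : normedModType R} (p : \bar R) (f : T -> X) : R :=
  fine (Lnorm mu p (fun s => (`|f s|)%:E)).
End Bochner.

(* Main.v *)
(** Locally octahedral case. If [t : X -> X] picks for every [x] an almost
    octahedral direction with [`|t x| = `|x|], then for countably valued [h]
    with [`|f - h| <= delta * `|f|] the function [t \o h], normalized, is almost
    octahedral for [f]: the inequality holds pointwise with [`|f s|] as a common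
    factor, so the lattice norm passes it on. Density of simple functions is
    not needed, which covers L^oo.

    Weakly octahedral case. A functional [phi] on E(X), restricted to the step
    functions over a finite partition [B i], splits into functionals [phi_ i] on
    X with norms [a i], and [h |-> \sum_i a i * h i] is bounded by the norm of
    the scalar step function [h], with best constant N <= 1. Take [y] equal to
    [b i *: y i] on [B i], where [b] almost attains N and [y i] is almost
    octahedral for the functional [phi_ i / a i]. A general finite-dimensional
    subspace is reduced to step functions by density; this needs coefficients
    bounded by the norm, obtained by compactness modulo null vectors. *)

Require Import Defs.
From HB Require Import structures.
From mathcomp Require Import all_boot all_order all_algebra.
From mathcomp Require Import all_classical all_reals all_analysis.
From mathcomp Require Import measurable_realfun ess_sup_inf ring lra.
Import Order.TTheory GRing.Theory Num.Theory.
Import numFieldNormedType.Exports.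
Local Open Scope classical_set_scope.
Local Open Scope ring_scope.

(** * Seminorms on finite-dimensional spaces *)

Section Seminorm_rV.
Context {R : realType} {n : nat} (q : 'rV[R]_n -> R).
Hypothesis qD : forall u v, q (u + v) <= q u + q v.
Hypothesis qZ : forall (a : R) u, q (a *: u) = `|a| * q u.

Lemma seminorm_rV0 : q 0 = 0.
Proof. by rewrite -(scale0r (0 : 'rV_n)) qZ normr0 mul0r. Qed.

Lemma seminorm_rVN u : q (- u) = q u.
Proof. by rewrite -scaleN1r qZ normrN1 mul1r. Qed.

Lemma seminorm_rV_ge0 u : 0 <= q u.
Proof.
have := qD u (- u); rewrite subrr seminorm_rV0 seminorm_rVN; lra.
Qed.

Lemma le_norm_rV (c : 'rV[R]_n) i : `|c ord0 i| <= `|c|.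
Proof.
rewrite [leRHS]/Num.norm /= mx_normrE; apply/bigmax_geP; right => /=.
by exists (ord0, i).
Qed.

Lemma seminorm_rV_lipschitz : exists2 L, 0 <= L & forall u, q u <= L * `|u|.
Proof.
exists (\sum_(i < n) q (delta_mx ord0 i)).
  by apply: sumr_ge0 => i _; exact: seminorm_rV_ge0.
move=> u; rewrite mulr_suml {1}[u]row_sum_delta.
have: q (\sum_(j < n) u ord0 j *: delta_mx ord0 j) <=
    \sum_(j < n) q (u ord0 j *: delta_mx ord0 j).
  elim/big_ind2: _ => [|x1 x2 y1 y2 h1 h2|//]; first by rewrite seminorm_rV0.
  by apply: (le_trans (qD _ _)); exact: lerD.
move=> /le_trans; apply; apply: ler_sum => i _.
by rewrite qZ mulrC ler_wpM2l ?seminorm_rV_ge0 ?le_norm_rV.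
Qed.

Lemma seminorm_rV_continuous : continuous q.
Proof.
have [L L0 qL] := seminorm_rV_lipschitz.
move=> u; apply/(@cvgrPdist_le _ _ _ (nbhs u) (nbhs_filter u)) => e e0.
apply/nbhs_ballP; exists (e / (L + 1)) => /= [|v]; last rewrite -ball_normE => /= /ltW h.
  by rewrite divr_gt0//; lra.
have : q (u - v) <= e.
  apply: (le_trans (qL _)); apply: (@le_trans _ _ (L * (e / (L + 1)))).
    by rewrite ler_wpM2l.
  rewrite mulrCA ger_pMr// ler_pdivrMr; lra.
rewrite ler_distl => quv.
have := qD (u - v) v; rewrite subrK => h1.
have := qD (v - u) u; rewrite subrK -(opprB u v) seminorm_rVN => h2.
by apply/andP; split; lra.
Qed.

(* Induction on the support [J]: a nonzero null vector of the seminorm lets one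
   coordinate be eliminated; without null vectors, compactness of the sphere
   gives the bound. *)
Lemma seminorm_rV_supp (k : nat) (J : {set 'I_n}) : (#|J| <= k)%N ->
  exists2 C, 0 <= C & forall c : 'rV[R]_n, (forall i, i \notin J -> c ord0 i = 0) ->
    exists2 c', q (c - c') = 0 & `|c'| <= C * q c.
Proof.
elim: k J => [|k IH] J Jk.
  exists 0 => // c cJ; exists 0; last by rewrite normr0 mul0r.
  suff -> : c = 0 by rewrite subr0 seminorm_rV0.
  apply/rowP => i; rewrite mxE cJ//.
  by move: Jk; rewrite leqn0 cards_eq0 => /eqP ->; rewrite inE.
have [[v [vJ v0 qv]]|nov] := pselect (exists v : 'rV[R]_n,
    [/\ forall i, i \notin J -> v ord0 i = 0, v != 0 & q v = 0]).
  have [j vj] : exists j, v ord0 j != 0.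
    apply/existsP; apply: contraNT v0; rewrite negb_exists => /forallP h.
    by apply/eqP/rowP => i; rewrite mxE; apply/eqP; have := h i; rewrite negbK.
  have jJ : j \in J by apply: contraNT vj => /vJ ->.
  have [|C C0 HC] := IH (J :\ j)%SET.
    by rewrite (cardsD1 j J) jJ in Jk.
  exists C => // c cJ.
  pose w := c - (c ord0 j / v ord0 j) *: v.
  have qcw : q (c - w) = 0 by rewrite /w opprB addrCA subrr addr0 qZ qv mulr0.
  have [i|c' h1 h2] := HC w.
    rewrite !inE negb_and negbK => /orP[/eqP ->|iJ].
      by rewrite !mxE divfK ?subrr.
    by rewrite !mxE (cJ _ iJ) (vJ _ iJ) mulr0 subrr.
  exists c'.
    apply/eqP; rewrite eq_le seminorm_rV_ge0 andbT.
    by have := qD (c - w) (w - c'); rewrite addrA subrK qcw h1 addr0.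
  apply: (le_trans h2); rewrite ler_wpM2l//.
  have := qD (w - c) c; rewrite subrK -opprB seminorm_rVN qcw.
  by rewrite add0r.
pose A := [set c : 'rV[R]_n | `|c| = 1] `&`
  \bigcap_(i in [set i | i \notin J]) [set c : 'rV[R]_n | c ord0 i = 0].
have clA : closed A.
  apply: closedI.
    have -> : [set c : 'rV[R]_n | `|c| = 1] = Num.norm @^-1` [set 1] by [].
    apply: closed_comp; last exact: closed_eq.
    by move=> x _; exact: norm_continuous.
  apply: closed_bigI => i _.
  have -> : [set c : 'rV[R]_n | c ord0 i = 0] = (fun c : 'rV[R]_n => c ord0 i) @^-1` [set 0] by [].
  apply: closed_comp; last exact: closed_eq.
  by move=> x _; exact: coord_continuous.
have cA : compact A.
  apply: bounded_closed_compact => //.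
  exists 1; split => // x x1 c [/= -> _]; exact: ltW.
have [A0|A0] := pselect (A !=set0); last first.
  exists 0 => // c cJ; exists 0; last by rewrite normr0 mul0r.
  have [->|c0] := eqVneq c 0; first by rewrite subr0 seminorm_rV0.
  exfalso; apply: A0; exists (`|c|^-1 *: c); split => /=.
    by rewrite normrZ normfV normr_id mulVf ?normr_eq0.
  by move=> i /= iJ; rewrite mxE cJ ?mulr0.
have [a /set_mem[/= a1 aJ] amin] := EVT_min_rV A0 cA
  (continuous_subspaceT seminorm_rV_continuous).
have qa : 0 < q a.
  rewrite lt_neqAle seminorm_rV_ge0 andbT eq_sym; apply/negP => /eqP qa.
  apply: nov; exists a; split; [by move=> i; exact: aJ| |exact: qa].
  by rewrite -normr_eq0 a1 oner_eq0.
exists (q a)^-1; first by rewrite invr_ge0 ltW.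
move=> c cJ; exists c; first by rewrite subrr seminorm_rV0.
have [->|c0] := eqVneq c 0; first by rewrite normr0 seminorm_rV0 mulr0.
have := amin (`|c|^-1 *: c); rewrite qZ normfV normr_id.
rewrite ler_pdivlMl ?normr_gt0// ler_pdivlMl// mulrC => -> //.
apply/mem_set; split => /=.
  by rewrite normrZ normfV normr_id mulVf ?normr_eq0.
by move=> i /= iJ; rewrite mxE cJ ?mulr0.
Qed.

(** Spanning vectors may be linearly dependent or agree a.e., so the norm of a combination does not
    control its coefficients; it controls those of some combination at distance zero. *)
Lemma seminorm_rV_bounded_rep : exists2 C, 0 <= C & forall c : 'rV[R]_n,
  exists2 c', q (c - c') = 0 & `|c'| <= C * q c.
Proof.
have [C C0 H] := seminorm_rV_supp (#|[set: 'I_n]%SET|) [set: 'I_n]%SET (leqnn _).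
by exists C => // c; apply: H => i; rewrite inE.
Qed.

End Seminorm_rV.

(** * Step functions and Bochner measurability *)

Section Step.
Context {R : realType} {d : measure_display} {T : measurableType d}.
Variable mu : {measure set T -> \bar R}.

(** The index is any finite type, since common refinements are indexed by membership patterns; the
    pieces may overlap. *)
Definition step {V : lmodType R} {I : finType} (A : I -> set T) (x : I -> V) : T -> V :=
  fun s => \sum_(i : I) (\1_(A i) s : R) *: x i.

Definition finite_sets {I : finType} (A : I -> set T) : Prop :=
  forall i, measurable (A i) /\ (mu (A i) < +oo)%E.

Definition disjoint_sets {I : finType} (A : I -> set T) : Prop :=
  forall i j, i != j -> A i `&` A j = set0.

Lemma step_in {V : lmodType R} {I : finType} (A : I -> set T) (x : I -> V) i s :
  disjoint_sets A -> A i s -> step A x s = x i.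
Proof.
move=> dA Ais; rewrite /step (bigD1 i)//= indicE mem_set// scale1r big1 ?addr0//.
move=> j ji; rewrite indicE memNset ?scale0r// => Ajs.
by have := dA _ _ ji; rewrite -subset0; apply; split; [exact: Ajs|exact: Ais].
Qed.

Lemma step_out {V : lmodType R} {I : finType} (A : I -> set T) (x : I -> V) s :
  (forall i, ~ A i s) -> step A x s = 0.
Proof.
by move=> nA; rewrite /step big1// => j _; rewrite indicE memNset ?scale0r.
Qed.

(** [t] acts on the values piece by piece; [t 0 = 0] takes care of the points outside every
    piece. *)
Lemma step_comp {V W : lmodType R} {I : finType} (A : I -> set T) (x : I -> V)
    (t : V -> W) : disjoint_sets A -> t 0 = 0 ->
  (fun s => t (step A x s)) = step A (t \o x).
Proof.
move=> dA t0; apply/funext => s.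
have [[i Ais]|nA] := pselect (exists i, A i s).
  by rewrite !(step_in _ _ _ _ dA Ais).
have {}nA i : ~ A i s by move=> Ais; apply: nA; exists i.
by rewrite !step_out.
Qed.

(* The refinement is indexed by membership patterns [p]: [B p] is the set of points
   that lie in exactly the sets [A j k] with [p (j, k)], for nonempty [p]. *)
Lemma step_refine {V : lmodType R} {J : finType} (K : J -> finType)
    (A : forall j, K j -> set T) (x : forall j, K j -> V) :
  (forall j, finite_sets (A j)) ->
  exists (I : finType) (B : I -> set T) (z : J -> I -> V),
    [/\ finite_sets B, disjoint_sets B & forall j, step (A j) (x j) = step B (z j)].
Proof.
move=> fA.
pose U := {j : J & K j}.
pose AU (u : U) := A (tag u) (tagged u).
pose B (p : {ffun U -> bool}) :=
  [set s | [exists u, p u] /\ forall u, p u = (s \in AU u)].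
(* On [B p] the [j]-th step function is the sum of those of its values that [p] selects, which
   allows for overlapping pieces. *)
exists {ffun U -> bool}, B,
  (fun j (p : {ffun U -> bool}) => \sum_(k : K j)
     ((p (Tagged (fun j => K j : Type) k) : nat)%:R : R) *: x j k); split.
(* The empty pattern would describe the complement of all pieces, possibly of infinite measure; [B]
   makes it the empty set. For any other pattern a selected piece bounds the measure. *)
- move=> p; have [/existsP[u pu]|np] := boolP [exists u, p u]; last first.
    have -> : B p = set0 by rewrite -subset0 => s [] /=; rewrite (negbTE np).
    by rewrite measure0; split.
  have mB : measurable (B p).
    have -> : B p = \big[setI/setT]_(u : U) (if p u then AU u else ~` AU u).
      apply/seteqP; split => [s [_ ps]|s].
        rewrite -bigcap_seq => v _ /=.
        by have := ps v; case: ifP => _ /esym; [move/set_mem|move/negbT; rewrite notin_setE].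
      rewrite -bigcap_seq => h; split => [|v]; first by apply/existsP; exists u.
      have := h v; rewrite /= mem_index_enum => /(_ isT); case: ifP => _ hv.
        by rewrite mem_set.
      by rewrite memNset.
    apply: bigsetI_measurable => v _; case: ifP => _.
      exact: (fA _ _).1.
    by apply: measurableC; exact: (fA _ _).1.
  split => //; apply: le_lt_trans (fA (tag u) (tagged u)).2.
  apply: le_measure; rewrite ?inE//; first exact: (fA _ _).1.
  by move=> s [_ /(_ u)]; rewrite pu => /esym/set_mem.
- move=> p p' pp'; rewrite -subset0 => s [[_ ps] [_ p's]].
  by move/eqP: pp'; apply; apply/ffunP => u; rewrite ps p's.
- have dB : disjoint_sets B.
    move=> p p' pp'; rewrite -subset0 => s [[_ ps] [_ p's]].
    by move/eqP: pp'; apply; apply/ffunP => u; rewrite ps p's.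
  move=> j; apply/funext => s.
  pose p := [ffun u => s \in AU u].
  have [ep|np] := boolP [exists u, p u].
    have Bps : B p s by split => // u; rewrite ffunE.
    by rewrite (step_in _ _ _ _ dB Bps); apply: eq_bigr => k _; rewrite ffunE indicE.
  rewrite (step_out B); last first.
    move=> p' [/existsP[u p'u] h]; move/negP: np; apply; apply/existsP; exists u.
    by rewrite ffunE -h.
  rewrite step_out// => k Ajk; move/negP: np; apply.
  by apply/existsP; exists (Tagged (fun j => K j : Type) k); rewrite ffunE mem_set.
Qed.

(** Refining first restores the disjointness that a simple function requires, and enumeration turns
    the index type into an ordinal. *)
Lemma simple_fun_step {X : normedModType R} {I : finType} (A : I -> set T) (x : I -> X) :
  finite_sets A -> simple_fun mu (step A x).
Proof.
move=> fA.
have [I' [B [z [fB dB /(_ tt) ->]]]] :=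
  @step_refine X unit (fun _ => I) (fun _ => A) (fun _ => x) (fun _ => fA).
exists #|I'|, (B \o enum_val), (z tt \o enum_val); split.
- by move=> i; exact: fB.
- move=> i j ij; apply: dB; apply: contraNneq ij => /enum_val_inj ->; exact: eqxx.
- apply/funext => s; rewrite /step (reindex_onto enum_val enum_rank)/=; last first.
    by move=> i _; rewrite enum_rankK.
  by apply: eq_bigl => i; rewrite enum_valK eqxx.
Qed.

Lemma simple_fun_refine {X : normedModType R} {J : finType} (g : J -> T -> X) :
  (forall j, simple_fun mu (g j)) ->
  exists (I : finType) (B : I -> set T) (z : J -> I -> X),
    [/\ finite_sets B, disjoint_sets B & forall j, g j = step B (z j)].
Proof.
move=> /(_ _)/cid -/all_sig[m] /(_ _)/cid -/all_sig[A] /(_ _)/cid -/all_sig[x h].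
have [j|I [B [z [fB dB e]]]] := @step_refine X J (fun j => 'I_(m j)) A x.
  by case: (h j).
by exists I, B, z; split => // j; rewrite -e; case: (h j).
Qed.

Lemma simple_funD {X : normedModType R} (f g : T -> X) :
  simple_fun mu f -> simple_fun mu g -> simple_fun mu (fun s => f s + g s).
Proof.
move=> sf sg.
have [[]//|I [B [z [fB dB e]]]] := simple_fun_refine (fun b : bool => if b then f else g).
have -> : (fun s => f s + g s) = step B (fun i => z true i + z false i).
  apply/funext => s; have := e true; have := e false => -> ->.
  by rewrite /step -big_split; apply: eq_bigr => i _; rewrite scalerDr.
exact: simple_fun_step.
Qed.

Lemma simple_fun_disj {X : normedModType R} (g : T -> X) : simple_fun mu g ->
  exists (I : finType) (B : I -> set T) (z : I -> X),
    [/\ finite_sets B, disjoint_sets B & g = step B z].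
Proof. by move=> [m [A [x [fA dA ->]]]]; exists 'I_m, A, x. Qed.

Lemma simple_fun_comp {X Y : normedModType R} (t : X -> Y) (g : T -> X) : t 0 = 0 ->
  simple_fun mu g -> simple_fun mu (fun s => t (g s)).
Proof.
move=> t0 /simple_fun_disj[I [B [z [fB dB ->]]]].
by rewrite step_comp//; exact: simple_fun_step.
Qed.

Lemma simple_fun_indic {X : normedModType R} (C : set T) (g : T -> X) :
  measurable C -> simple_fun mu g -> simple_fun mu (fun s => (\1_C s : R) *: g s).
Proof.
move=> mC /simple_fun_disj[I [B [z [fB dB ->]]]].
have -> : (fun s => (\1_C s : R) *: step B z s) = step (fun i => C `&` B i) z.
  apply/funext => s; rewrite /step scaler_sumr; apply: eq_bigr => i _.
  by rewrite scalerA indicI.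
apply: simple_fun_step => i; have [mB fBi] := fB i; split; first exact: measurableI.
by apply: le_lt_trans fBi; apply: le_measure; rewrite ?inE//; exact: measurableI.
Qed.

Lemma simple_fun0 {X : normedModType R} : simple_fun mu (fun _ => 0 : X).
Proof.
exists 0%N, (fun _ => set0), (fun _ => 0); split => [[]//|[]//|].
by apply/funext => s; rewrite big_ord0.
Qed.

Lemma simple_fun_indic_cst {X : normedModType R} (A : set T) (x : X) :
  measurable A -> (mu A < +oo)%E -> simple_fun mu (fun s => (\1_A s : R) *: x).
Proof.
move=> mA fA; exists 1%N, (fun _ => A), (fun _ => x); split => //.
  by move=> i j; rewrite !ord1.
by apply/funext => s; rewrite big_ord1.
Qed.

Lemma simple_fun_sum {X : normedModType R} {J : Type} (r : seq J) (g : J -> T -> X) :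
  (forall j, simple_fun mu (g j)) -> simple_fun mu (fun s => \sum_(j <- r) g j s).
Proof.
move=> sg; elim: r => [|j r IH].
  by under eq_fun do rewrite big_nil; exact: simple_fun0.
by under eq_fun do rewrite big_cons; exact: simple_funD.
Qed.

Lemma simple_fun_normr {X : normedModType R} (g : T -> X) :
  simple_fun mu g -> measurable_fun [set: T] (fun s => `|g s|).
Proof.
move=> /simple_fun_disj[I [B [z [fB dB ->]]]].
have -> : (fun s => `|step B z s|) = (fun s => \sum_(i : I) \1_(B i) s * `|z i|).
  by rewrite (step_comp B z (Num.norm : X -> R^o) dB (normr0 _)).
apply: measurable_sum => i; apply: measurable_funM => //.
exact: measurable_indic (fB i).1.
Qed.

End Step.

(** * Norms and countably valued approximations of Bochner-measurable functions *)

Section Bochner_measurability.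
Context {R : realType} {d : measure_display} {T : measurableType d}.
Variable mu : {measure set T -> \bar R}.
Context {X : normedModType R}.

Lemma simple_fun_bochner (f : T -> X) : simple_fun mu f -> bochner_measurable mu f.
Proof.
by move=> sf; exists (fun _ => f); split => //; apply: aeW => s; exact: cvg_cst.
Qed.

Lemma bochner_measurableD (f g : T -> X) : bochner_measurable mu f ->
  bochner_measurable mu g -> bochner_measurable mu (fun s => f s + g s).
Proof.
move=> [u [su uf]] [v [sv vg]]; exists (fun n s => u n s + v n s); split.
  by move=> n; exact: simple_funD.
by apply: filterS2 uf vg => s us vs; exact: cvgD.
Qed.

Lemma bochner_measurableZ (a : R) (f : T -> X) : bochner_measurable mu f ->
  bochner_measurable mu (fun s => a *: f s).
Proof.
move=> [u [su uf]]; exists (fun n s => a *: u n s); split.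
  by move=> n; apply: (simple_fun_comp mu ( *:%R a)) => //; rewrite scaler0.
by apply: filterS uf => s us; exact: cvgZr.
Qed.

Hypothesis cmu : measure_is_complete mu.

(** Cut off outside a measurable null set, the functions converge everywhere, so the limit is
    measurable; completeness of [mu] passes this on to [f], which differs from that limit only on
    the null set. *)
Lemma ae_cvg_measurable (u : nat -> T -> R) (f : T -> R) :
  (forall n, measurable_fun [set: T] (u n)) ->
  {ae mu, forall s, (fun n => u n s) @ \oo --> f s} -> measurable_fun [set: T] f.
Proof.
move=> mu_ [N [mN N0 sN]].
pose g := fun s => if s \in N then 0 else f s.
have mg : measurable_fun [set: T] g.
  apply: (@measurable_fun_cvg _ _ _ _ (fun n s => \1_(~` N) s * u n s)) => [n|s _].
    by apply: measurable_funM => //; apply: measurable_indic; exact: measurableC.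
  rewrite /g; case: ifPn => sNN.
    rewrite indicE memNset ?mul0r; last by move/set_mem: sNN => ? /=.
    by under eq_fun do rewrite mul0r; exact: cvg_cst.
  rewrite indicE mem_set; last by rewrite notin_setE in sNN.
  under eq_fun do rewrite mul1r.
  by apply: contrapT => h; move: sNN; rewrite notin_setE; apply; apply: sN.
apply/measurable_EFinP.
apply: (@ae_measurable_fun _ _ _ _ cmu setT (EFin \o g)); last exact/measurable_EFinP.
exists N; split => // s /=; rewrite /g; case: ifPn => [/set_mem//|_ h].
by exfalso; apply: h.
Qed.

Lemma bochner_measurable_normr (f : T -> X) : bochner_measurable mu f ->
  measurable_fun [set: T] (fun s => `|f s|).
Proof.
move=> [u [su uf]]; apply: (ae_cvg_measurable (fun n s => `|u n s|)).
  by move=> n; exact: simple_fun_normr (su n).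
by apply: filterS uf => s us; exact: cvg_norm.
Qed.

(** [h] equals [k n] where [n] is the first index at which the simple function [k n] has relative
    error below [delta], and 0 where there is none, which a.e. means [f s = 0]. The truncations
    [g n] are eventually constant at each point, so that their convergence survives composition with
    an arbitrary map. *)
Lemma bochner_measurable_approx (f : T -> X) (delta : R) :
  bochner_measurable mu f -> 0 < delta ->
  exists (h : T -> X) (g : nat -> T -> X), [/\ forall n, simple_fun mu (g n),
    forall s, exists N, forall n, (N <= n)%N -> g n s = h s,
    forall n s, g n s = h s \/ g n s = 0 &
    {ae mu, forall s, `|f s - h s| <= delta * `|f s|}].
Proof.
move=> bf d0; have [k [sk kf]] := bf.
pose D n := [set s | `|f s - k n s| < delta * `|f s|].
have mD n : measurable (D n).
  have mb : measurable_fun [set: T] (fun s => `|f s - k n s| < delta * `|f s|).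
    apply: measurable_fun_ltr.
      apply: bochner_measurable_normr; apply: bochner_measurableD => //.
      apply: simple_fun_bochner; apply: (simple_fun_comp mu (@GRing.opp X)) => //.
      exact: oppr0.
    by apply: measurable_funM => //; exact: bochner_measurable_normr.
  by rewrite -[D n]setTI; exact: (mb measurableT [set true]).
pose B := seqDU D.
have mB n : measurable (B n) by exact: seqDU_measurable.
pose h s := if pselect (exists i, B i s) is left e then k (sval (cid e)) s else 0.
pose g n s := \sum_(i < n) (\1_(B i) s : R) *: k i s.
have uB i j s : B i s -> B j s -> i = j.
  move=> Bi Bj; apply: (@trivIset_seqDU _ D) => //; by exists s.
have hB i s : B i s -> h s = k i s.
  move=> Bi; rewrite /h; case: pselect => [e|/(_ (ex_intro _ i Bi))//].
  by case: cid => j /= Bj; rewrite (uB _ _ _ Bi Bj).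
have gB i n s : B i s -> g n s = if (i < n)%N then k i s else 0.
  move=> Bi; rewrite /g; case: ifPn => [ltin|nin].
    rewrite (bigD1 (Ordinal ltin))//= big1 ?addr0.
      by rewrite indicE mem_set// scale1r.
    move=> j ji; rewrite indicE memNset ?scale0r// => Bj; move/eqP: ji; apply.
    by apply/val_inj; exact: uB Bj Bi.
  rewrite big1// => j _; rewrite indicE memNset ?scale0r// => Bj.
  by move: nin; rewrite (uB _ _ _ Bi Bj) ltn_ord.
have hN s : ~ (exists i, B i s) -> h s = 0.
  by rewrite /h; case: pselect.
have gN n s : ~ (exists i, B i s) -> g n s = 0.
  move=> nB; rewrite /g big1// => j _; rewrite indicE memNset ?scale0r// => Bj.
  by apply: nB; exists j.
exists h, g; split.
- by move=> n; apply: simple_fun_sum => i; exact: simple_fun_indic.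
- move=> s; have [[i Bi]|nB] := pselect (exists i, B i s); last first.
    by exists 0%N => n _; rewrite hN ?gN.
  by exists i.+1 => n ltin; rewrite (gB _ _ _ Bi) ltin (hB _ _ Bi).
- move=> n s; have [[i Bi]|nB] := pselect (exists i, B i s); last by right; exact: gN.
  by rewrite (gB _ _ _ Bi) (hB _ _ Bi); case: ifP; [left|right].
- apply: filterS kf => s ks; have [[i Bi]|nB] := pselect (exists i, B i s).
    by rewrite (hB _ _ Bi); apply: ltW; exact: (subset_seqDU Bi).
  rewrite hN// subr0; have [->|f0] := eqVneq (f s) 0; first by rewrite normr0 mulr0.
  (* Where [f s] is nonzero the allowed error is positive, so convergence puts [s] into some
     [D N]. *)
  exfalso; apply: nB.
  have e0 : 0 < delta * `|f s| by rewrite mulr_gt0 ?normr_gt0.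
  have /cvgrPdist_lt /(_ _ e0) [N _ /(_ N (leqnn N))/= DN] := ks.
  have : (\bigcup_n D n) s by exists N.
  by rewrite seqDU_bigcup_eq => -[i _ Bi]; exists i.
Qed.

End Bochner_measurability.

(** * Spaces of vector-valued functions over an ideal norm *)

Section Ideal_norm.
Context {R : realType} {d : measure_display} {T : measurableType d}.
Variable mu : {measure set T -> \bar R}.

(* The part of [is_Kothe] that the argument uses; it is also satisfied by
   L^p for every p in [1, oo]. *)
Record ideal_norm (E : set (T -> R)) (nE : (T -> R) -> R) : Prop := {
  ideal_norm_meas : forall f, E f -> measurable_fun setT f;
  ideal_norm_add : forall f g, E f -> E g -> E (f \+ g);
  ideal_norm_scale : forall (a : R) f, E f -> E (fun s => a * f s);
  ideal_norm_triangle : forall f g, E f -> E g -> nE (f \+ g) <= nE f + nE g;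
  ideal_norm_homog : forall (a : R) f, E f -> nE (fun s => a * f s) = `|a| * nE f;
  ideal_norm_indic : forall A, measurable A -> (mu A < +oo)%E -> E (\1_A : T -> R);
  ideal_norm_indic_gt0 : forall A, measurable A -> (0 < mu A)%E -> (mu A < +oo)%E ->
    0 < nE (\1_A : T -> R);
  ideal_norm_ideal : forall f (g : T -> R), E f -> measurable_fun setT g ->
    {ae mu, forall s, `|g s| <= `|f s|} -> E g /\ nE g <= nE f }.

Variables (E : set (T -> R)) (nE : (T -> R) -> R).
Hypothesis K : ideal_norm E nE.

Lemma ideal_norm_ge0 f : E f -> 0 <= nE f.
Proof.
move=> Ef; have h0 : nE (fun s => 0 * f s) = 0.
  by rewrite (ideal_norm_homog _ _ K)// normr0 mul0r.
have := ideal_norm_triangle _ _ K _ _ Ef (ideal_norm_scale _ _ K (-1) _ Ef).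
rewrite (ideal_norm_homog _ _ K)// normrN1 mul1r.
have -> : (f \+ (fun s => -1 * f s)) = (fun s => 0 * f s).
  by apply/funext => s /=; rewrite mulN1r subrr mul0r.
rewrite h0; lra.
Qed.

Lemma ideal_norm_cst0 (A : set T) : measurable A -> (mu A < +oo)%E -> E (fun _ => 0).
Proof.
move=> mA fA; have := ideal_norm_scale _ _ K 0 _ (ideal_norm_indic _ _ K _ mA fA).
by under eq_fun do rewrite mul0r.
Qed.

Hypothesis cmu : measure_is_complete mu.
Context {X : normedModType R}.
Implicit Types f g : T -> X.

(** This and [nEX_lower] turn pointwise estimates into norm estimates. *)
Lemma EX_dominated f (h : T -> R) : bochner_measurable mu f -> E h ->
  {ae mu, forall s, `|f s| <= h s} -> EX mu E f /\ nEX nE f <= nE h.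
Proof.
move=> bf Eh fh.
have [|Ef nf] := ideal_norm_ideal _ _ K _ _ Eh (bochner_measurable_normr mu cmu f bf).
  by apply: filterS fh => s fhs; rewrite normr_id (le_trans fhs)// ler_norm.
by [].
Qed.

Lemma nEX_lower f (h : T -> R) : EX mu E f -> measurable_fun setT h ->
  {ae mu, forall s, 0 <= h s <= `|f s|} -> nE h <= nEX nE f.
Proof.
move=> [bf Ef] mh hf; apply: (ideal_norm_ideal _ _ K _ _ Ef mh _).2.
by apply: filterS hf => s /andP[h0 hfs]; rewrite normr_id ger0_norm.
Qed.

Lemma EXD f g : EX mu E f -> EX mu E g ->
  EX mu E (f + g) /\ nEX nE (f + g) <= nEX nE f + nEX nE g.
Proof.
move=> [bf Ef] [bg Eg].
have [|Efg nfg] := @EX_dominated (f + g) _ (bochner_measurableD mu _ _ bf bg)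
  (ideal_norm_add _ _ K _ _ Ef Eg).
  by apply: aeW => s; exact: ler_normD.
by split => //; apply: (le_trans nfg); exact: (ideal_norm_triangle _ _ K).
Qed.

Lemma EXZ (a : R) f : EX mu E f -> EX mu E (a *: f) /\ nEX nE (a *: f) = `|a| * nEX nE f.
Proof.
move=> [bf Ef].
have e : (fun s => `|(a *: f) s|) = (fun s => `|a| * `|f s|).
  by apply/funext => s; exact: normrZ.
rewrite /EX /nEX/= e; split; last by rewrite (ideal_norm_homog _ _ K)// normr_id.
by split; [exact: bochner_measurableZ|exact: (ideal_norm_scale _ _ K)].
Qed.

Lemma EXB f g : EX mu E f -> EX mu E g -> EX mu E (f - g).
Proof.
move=> Ef Eg; rewrite -scaleN1r; apply: (EXD _ _ Ef _).1; exact: (EXZ _ _ Eg).1.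
Qed.

Lemma nEXN f : EX mu E f -> nEX nE (- f) = nEX nE f.
Proof. by move=> Ef; rewrite -scaleN1r (EXZ _ _ Ef).2 normrN1 mul1r. Qed.

Lemma nEXBC f g : EX mu E f -> EX mu E g -> nEX nE (f - g) = nEX nE (g - f).
Proof. by move=> Ef Eg; rewrite -opprB nEXN//; exact: EXB. Qed.

Lemma nEX_ge0 f : EX mu E f -> 0 <= nEX nE f.
Proof. by move=> [_ Ef]; exact: ideal_norm_ge0. Qed.

Lemma nEX_lipschitz f g : EX mu E f -> EX mu E g -> nEX nE f <= nEX nE g + nEX nE (f - g).
Proof.
move=> Ef Eg; have := (EXD _ _ Eg (EXB _ _ Ef Eg)).2.
by rewrite addrC subrK.
Qed.

Lemma EX_sum {J : Type} (r : seq J) (c : J -> R) (g : J -> T -> X) (A : set T) :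
  measurable A -> (mu A < +oo)%E ->
  (forall j, EX mu E (g j)) -> EX mu E (\sum_(j <- r) c j *: g j).
Proof.
move=> mA fA Eg; elim: r => [|j r IH]; last first.
  rewrite big_cons; exact: (EXD _ _ (EXZ _ _ (Eg j)).1 IH).1.
rewrite big_nil; split; first exact: (simple_fun_bochner mu _ (simple_fun0 mu)).
have -> : (fun s => `|(0 : T -> X) s|) = (fun _ => 0) by apply/funext => s; exact: normr0.
exact: ideal_norm_cst0 fA.
Qed.

Lemma nEX_sum {J : Type} (r : seq J) (c : J -> R) (g : J -> T -> X) (A : set T) :
  measurable A -> (mu A < +oo)%E ->
  (forall j, EX mu E (g j)) ->
  nEX nE (\sum_(j <- r) c j *: g j) <= \sum_(j <- r) `|c j| * nEX nE (g j).
Proof.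
move=> mA fA Eg; elim: r => [|j r IH]; last first.
  rewrite !big_cons; apply: (le_trans (EXD _ _ (EXZ _ _ (Eg j)).1 _).2).
    exact: EX_sum fA _.
  by rewrite (EXZ _ _ (Eg j)).2 lerD2l.
rewrite !big_nil /nEX.
have := ideal_norm_homog _ _ K 0 _ (ideal_norm_cst0 _ mA fA).
have -> : (fun s => `|(0 : T -> X) s|) = (fun _ => 0 * 0) :> (T -> R).
  by apply/funext => s; rewrite mul0r; exact: normr0.
by move=> ->; rewrite normr0 mul0r.
Qed.

Lemma ideal_norm_step {I : finType} (B : I -> set T) (h : I -> R) (A : set T) :
  measurable A -> (mu A < +oo)%E -> finite_sets mu B -> E (step B (h : I -> R^o)).
Proof.
move=> mA fA fB; rewrite /step.
elim: (index_enum I) => [|i r IH].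
  by under eq_fun do rewrite big_nil; exact: ideal_norm_cst0 fA.
under eq_fun do rewrite big_cons.
apply: (ideal_norm_add _ _ K _ _ _ IH).
have -> : (fun s => (\1_(B i) s : R) *: (h i : R^o)) = (fun s => h i * \1_(B i) s).
  by apply/funext => s; rewrite mulrC.
by apply: (ideal_norm_scale _ _ K); apply: (ideal_norm_indic _ _ K); have [] := fB i.
Qed.

Lemma EX_simple f : simple_fun mu f -> EX mu E f.
Proof.
move=> sf; split; first exact: simple_fun_bochner.
have [I [B [z [fB dB ->]]]] := simple_fun_disj mu f sf.
rewrite (step_comp B z (Num.norm : X -> R^o) dB (normr0 _)).
apply: (ideal_norm_step B _ set0) => //; by rewrite measure0.
Qed.

End Ideal_norm.

(** Only the positive norm of an indicator is not an axiom: norm zero would make [\1_A] vanish a.e.,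
    and [A] would be null. *)
Lemma Kothe_ideal_norm {R : realType} {d : measure_display} {T : measurableType d}
    (mu : {measure set T -> \bar R}) (E : set (T -> R)) (nE : (T -> R) -> R) :
  is_Kothe mu E nE -> ideal_norm mu E nE.
Proof.
move=> [h1 h2 h3 h4 h5 h6 _ h8 _ h10]; split=> //.
move=> A mA muA fA; have EA := h8 _ mA fA.
rewrite lt_neqAle; apply/andP; split; last first.
  have := h4 _ _ EA (h3 (-1) _ EA); rewrite h5// normrN1 mul1r.
  have -> : ((\1_A : T -> R) \+ (fun s => -1 * \1_A s)) = (fun s => 0 * \1_A s).
    by apply/funext => s /=; rewrite mulN1r subrr mul0r.
  rewrite h5// normr0 mul0r; lra.
apply/eqP => /esym /(h6 _ EA) [N [mN N0 AN]].
have : (mu A <= mu N)%E.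
  apply: le_measure; rewrite ?inE// => s As; apply: AN => /= /(_ I).
  by rewrite indicE mem_set// => /eqP; rewrite oner_eq0.
by rewrite N0 leNgt muA.
Qed.

(** A countable cover by null sets would make the whole space null. The set found here carries the
    norm-one elements of E(X). *)
Lemma sigma_finite_pos_set {R : realType} {d : measure_display} {T : measurableType d}
    (mu : {measure set T -> \bar R}) :
  sigma_finite [set: T] mu -> (0 < mu [set: T])%E ->
  exists A, [/\ measurable A, (0 < mu A)%E & (mu A < +oo)%E].
Proof.
move=> [F FT fF] muT; apply: contrapT => nA.
have F0 i : mu (F i) = 0%E.
  apply/eqP; rewrite eq_le measure_ge0 andbT leNgt; apply/negP => h.
  by apply: nA; exists (F i); have [] := fF i.
have mF i : measurable (F i) by have [] := fF i.
have : (mu setT <= \sum_(0 <= i <oo) mu (F i))%E.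
  by apply: measure_sigma_subadditive => //; rewrite FT.
rewrite eseries0; last by move=> i _ _; exact: F0.
by rewrite leNgt muT.
Qed.

(** * Local octahedrality *)

(** The homogeneous form of local octahedrality: with [t x] equal to [|x|] times the chosen
    direction, both sides scale with [|x|], as a pointwise use under a lattice norm requires. *)
Lemma LOH_direction {R : realType} (X : normedModType R) (e : R) : LOH X -> 0 < e ->
  exists t : X -> X, [/\ t 0 = 0, forall x, `|t x| = `|x| &
    forall (s k : R) x, 0 <= k -> (1 - e) * ((`|s| + k) * `|x|) <= `|s *: x + k *: t x|].
Proof.
move=> loh e0.
have /choice[y hy] : forall x : X, exists y : X, `|y| = 1 /\
    forall s : R, (1 - e) * (`|s| * `|x| + 1) <= `|s *: x + y|.
  by move=> x; have [y [_ y1 hy]] := loh x I e e0; exists y.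
exists (fun x => `|x| *: y x); split; first by rewrite normr0 scale0r.
  by move=> x; rewrite normrZ normr_id (hy x).1 mulr1.
move=> s k x k0; rewrite scalerA; have [kx0|kx0] := eqVneq (k * `|x|) 0.
  rewrite kx0 scale0r addr0 normrZ [(_ + k) * _]mulrDl kx0 addr0 ler_piMl ?mulr_ge0//; lra.
have kx : 0 < k * `|x| by rewrite lt_neqAle eq_sym kx0 mulr_ge0.
(* With the factor [k * |x|] taken out, the claim is the choice of [y x] at the scalar
   [s / (k * |x|)]. *)
have -> : s *: x + (k * `|x|) *: y x =
    (k * `|x|) *: ((s / (k * `|x|)) *: x + y x).
  by rewrite scalerDr scalerA mulrCA mulfV ?mulr1.
rewrite normrZ gtr0_norm// -ler_pdivrMl//.
apply: le_trans ((hy x).2 _); rewrite normrM normfV (gtr0_norm kx).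
rewrite le_eqVlt; apply/orP; left; apply/eqP.
by field; apply/andP; split; apply: contraNneq kx0 => ->; rewrite ?mulr0 ?mul0r.
Qed.

Section LOH_transfer.
Context {R : realType} {d : measure_display} {T : measurableType d}.
Variables (mu : {measure set T -> \bar R}) (E : set (T -> R)) (nE : (T -> R) -> R).
Hypotheses (K : ideal_norm mu E nE) (cmu : measure_is_complete mu).
Variables (A : set T) (mA : measurable A) (muA : (0 < mu A)%E) (fA : (mu A < +oo)%E).
Context {X : normedModType R}.

Lemma EX_unit_indic (z : X) : `|z| = 1 ->
  exists y : T -> X, [/\ simple_fun mu y, EX mu E y & nEX nE y = 1].
Proof.
move=> z1; have h := ideal_norm_indic_gt0 _ _ _ K _ mA muA fA.
pose y0 : T -> X := fun s => (\1_A s : R) *: z.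
have sy0 : simple_fun mu y0 by exact: simple_fun_indic_cst.
have Ey0 := EX_simple mu E nE K y0 sy0.
have ny0 : nEX nE y0 = nE (\1_A : T -> R).
  rewrite /nEX /y0; congr nE; apply/funext => s.
  by rewrite normrZ z1 mulr1 ger0_norm// indicE.
have [Ey ny] := EXZ mu E nE K (nE (\1_A : T -> R))^-1 y0 Ey0.
exists ((nE (\1_A : T -> R))^-1 *: y0); split => //; last first.
  by rewrite ny ny0 normfV gtr0_norm// mulVf ?gt_eqF.
by apply: (simple_fun_comp mu ( *:%R _) y0) => //; rewrite scaler0.
Qed.

Lemma LOH_EX : LOH X -> LOH_on (EX mu (X:=X) E) (nEX (X:=X) nE).
Proof.
move=> loh f Ef eps eps0.
have [f0|f0] := eqVneq (nEX nE f) 0.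
  (* Adding multiples of a null [f] leaves norms unchanged, so any norm-one element serves; [loh] at
     0 supplies a unit vector of [X]. *)
  have [z [_ z1 _]] := loh 0 I 1 ltr01.
  have [y [_ Ey y1]] := EX_unit_indic z z1.
  exists y; split => // s; rewrite f0 mulr0 add0r mulr1.
  have [Esf nsf] := EXZ mu E nE K s f Ef; rewrite f0 mulr0 in nsf.
  have Esfy := (EXD mu E nE K cmu _ _ Esf Ey).1.
  have := nEX_lipschitz mu E nE K cmu _ _ Ey Esfy.
  have -> : y - (s *: f + y) = - (s *: f) by rewrite opprD addrCA subrr addr0.
  by rewrite (nEXN mu E nE K)// nsf y1; lra.
have fpos : 0 < nEX nE f by rewrite lt_neqAle eq_sym f0 (nEX_ge0 mu E nE K).
(* Four errors of relative size [e] add up: the direction [t], the bound of [|h|] below by [|f|],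
   the exchange of [s *: h] for [s *: f], and the normalization by [k]. *)
pose e := Num.min eps 1 / 4.
have e0 : 0 < e by rewrite divr_gt0// lt_min eps0 ltr01.
have ee0 : 0 <= e * e by rewrite mulr_ge0// ltW.
have e4 : e <= 4^-1 by rewrite /e ler_pdivrMr// mulVf// ge_min lexx orbT.
have eeps : 4 * e <= eps by rewrite /e mulrC divfK// ge_min lexx.
have [t [t0 tn ht]] := LOH_direction X e loh e0.
have [bf Enf] := Ef.
have [h [g [sg gh _ fh]]] := bochner_measurable_approx mu cmu f e bf e0.
have bh : bochner_measurable mu h.
  exists g; split => //; apply: aeW => s; have [N hN] := gh s.
  apply: cvg_near_cst; exists N => // n /= Nn; exact/hN.
(* No continuity of [t] is involved: [g n s] is eventually equal to [h s], hence [t (g n s)] to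
   [t (h s)]. *)
have bth : bochner_measurable mu (fun s => t (h s)).
  exists (fun n s => t (g n s)); split; first by move=> n; exact: simple_fun_comp.
  apply: aeW => s; have [N hN] := gh s.
  by apply: cvg_near_cst; exists N => // n /= Nn; rewrite hN.
have Eef := ideal_norm_scale _ _ _ K (1 + e) _ Enf.
have hle : {ae mu, forall s, `|h s| <= (1 + e) * `|f s|}.
  apply: filterS fh => s fhs; have := ler_normB (f s) (f s - h s).
  by rewrite subKr; lra.
have hge : {ae mu, forall s, (1 - e) * `|f s| <= `|h s|}.
  apply: filterS fh => s fhs; have := ler_normD (f s - h s) (h s).
  by rewrite subrK; lra.
have [Eh nh] := EX_dominated mu E nE K cmu h _ bh Eef hle.
have [Eth nth] : EX mu E (fun s => t (h s)) /\ nEX nE (fun s => t (h s)) = nEX nE h.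
  have e1 : (fun s => `|t (h s)|) = (fun s => `|h s|) by apply/funext => s; rewrite tn.
  by rewrite /EX /nEX e1; split => //; split => //; have [] := Eh.
rewrite (ideal_norm_homog _ _ _ K)// in nh.
rewrite ger0_norm in nh; last lra.
rewrite -/(nEX nE f) in nh.
have nh' : (1 - e) * nEX nE f <= nEX nE h.
  have := nEX_lower mu E nE K h (fun s => (1 - e) * `|f s|) Eh.
  rewrite (ideal_norm_homog _ _ _ K)// ger0_norm; last lra.
  apply; first by apply: measurable_funM => //; exact: (bochner_measurable_normr mu cmu).
  apply: filterS hge => s ->; rewrite andbT mulr_ge0//; lra.
have hpos : 0 < nEX nE h by apply: lt_le_trans nh'; rewrite mulr_gt0//; lra.
pose k := (nEX nE h)^-1.
have k0 : 0 < k by rewrite invr_gt0.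
have [Ey ny] := EXZ mu E nE K k _ Eth.
exists (k *: (fun s => t (h s))); split => //.
  by rewrite ny nth gtr0_norm// /k mulVf// gt_eqF.
move=> s.
have Es := (EXD mu E nE K cmu _ _ (EXZ mu E nE K s f Ef).1 Ey).1.
have c0 : 0 <= (1 - 3 * e) * (`|s| + k).
  rewrite mulr_ge0 //; [lra|rewrite addr_ge0 //; exact: ltW].
have low : (1 - 3 * e) * (`|s| + k) * nEX nE f <= nEX nE (s *: f + k *: (fun s => t (h s))).
  have := nEX_lower mu E nE K _ (fun r => ((1 - 3 * e) * (`|s| + k)) * `|f r|) Es.
  rewrite (ideal_norm_homog _ _ _ K)// (ger0_norm c0).
  apply; first by apply: measurable_funM => //; exact: (bochner_measurable_normr mu cmu).
  apply: filterS2 fh hge => r fhr hger; rewrite mulr_ge0//=.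
  have tr : `|s *: h r + k *: t (h r)| <=
      `|(s *: f + k *: (fun s => t (h s))) r| + `|s| * (e * `|f r|).
    have -> : s *: h r + k *: t (h r) =
        (s *: f r + k *: t (h r)) - s *: (f r - h r).
      by rewrite scalerBr opprB [RHS]addrC -addrA addKr.
    apply: (le_trans (ler_normB _ _)); rewrite lerD2l normrZ.
    by rewrite ler_wpM2l.
  have := ht s k (h r) (ltW k0).
  set N := `|(_ + _) r| in tr *.
  have : (1 - e) * ((`|s| + k) * ((1 - e) * `|f r|)) <= (1 - e) * ((`|s| + k) * `|h r|).
    apply: ler_wpM2l; first lra.
    by apply: ler_wpM2l => //; rewrite addr_ge0// ltW.
  have := normr_ge0 s; have := normr_ge0 (f r).
  move: tr; move: `|s *: _ + _| `|h r| `|f r| `|s| N => a b F S N.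
  move=> h1 F0 S0 h2 h3.
  have SF : 0 <= S * F by exact: mulr_ge0.
  have kF : 0 <= k * F by rewrite mulr_ge0//; exact: ltW.
  have := mulr_ge0 (ltW e0) kF; have := mulr_ge0 (ltW e0) SF.
  have := mulr_ge0 ee0 kF; have := mulr_ge0 ee0 SF.
  nra.
apply: le_trans low.
(* The norm of [h] is at most [1 + e] times that of [f], and [(1 - e) * (1 + e) <= 1]. *)
have kf : 1 - e <= k * nEX nE f.
  rewrite /k mulrC ler_pdivlMr//; apply: le_trans (_ : (1 - e) * ((1 + e) * nEX nE f) <= _).
    by rewrite ler_wpM2l//; lra.
  have := mulr_ge0 ee0 (ltW fpos); nra.
rewrite -[X in _ <= X]mulrA [(_ + k) * _]mulrDl.
have P0 : 0 <= `|s| * nEX nE f by rewrite mulr_ge0//; exact: ltW.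
have q0 : 0 <= 1 - e by lra.
apply: (@le_trans _ _ ((1 - 4 * e) * (`|s| * nEX nE f + 1))).
  by rewrite ler_wpM2r//; lra.
apply: (@le_trans _ _ ((1 - 3 * e) * (`|s| * nEX nE f + (1 - e)))).
  have := mulr_ge0 (ltW e0) P0; have := ee0; nra.
by rewrite ler_wpM2l//; lra.
Qed.

End LOH_transfer.

(** * Weak octahedrality *)

Section WOH_step.
Context {R : realType} {d : measure_display} {T : measurableType d}.
Variables (mu : {measure set T -> \bar R}) (E : set (T -> R)) (nE : (T -> R) -> R).
Hypotheses (K : ideal_norm mu E nE) (cmu : measure_is_complete mu).
Context {I : finType} (B : I -> set T).
Hypotheses (fB : finite_sets mu B) (dB : disjoint_sets B).

(** A seminorm on coefficient vectors, degenerate when a piece is null; the ideal property makes it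
    monotone on nonnegative vectors. *)
Let q (h : I -> R) : R := nE (step B (h : I -> R^o)).

Lemma E_step (h : I -> R) : E (step B (h : I -> R^o)).
Proof. by apply: (ideal_norm_step mu E nE K B h set0) => //; rewrite measure0. Qed.

Lemma stepZ (a : R) (h : I -> R) :
  step B ((fun i => a * h i) : I -> R^o) = (fun s => a * step B (h : I -> R^o) s).
Proof.
apply/funext => s; rewrite /step mulr_sumr; apply: eq_bigr => i _.
exact: mulrCA.
Qed.

Lemma step_ge0 (h : I -> R) s : (forall i, 0 <= h i) -> 0 <= step B (h : I -> R^o) s.
Proof.
by move=> h0; rewrite /step; apply: sumr_ge0 => i _; apply: mulr_ge0 => //; rewrite indicE.
Qed.

Lemma step_norm_ge0 h : 0 <= q h.
Proof. exact: (ideal_norm_ge0 mu E nE K _ (E_step h)). Qed.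

Lemma step_normZ (a : R) h : q (fun i => a * h i) = `|a| * q h.
Proof. by rewrite /q stepZ (ideal_norm_homog _ _ _ K)//; exact: E_step. Qed.

Lemma step_norm_le h h' : (forall i, 0 <= h i <= h' i) -> q h <= q h'.
Proof.
move=> hh'; apply: (ideal_norm_ideal _ _ _ K _ _ (E_step h') _ _).2.
  exact: (ideal_norm_meas _ _ _ K _ (E_step h)).
apply: aeW => s; have h0 i : 0 <= h i by have /andP[] := hh' i.
have h'0 i : 0 <= h' i by have /andP[h1 h2] := hh' i; exact: le_trans h2.
rewrite !ger0_norm; [|exact: step_ge0|exact: step_ge0].
rewrite /step; apply: ler_sum => i _; apply: ler_wpM2l; first by rewrite indicE.
by have /andP[] := hh' i.
Qed.

Context {X : normedModType R}.

Lemma nEX_step (x : I -> X) : nEX nE (step B x) = q (fun i => `|x i|).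
Proof. by rewrite /nEX (step_comp B x (Num.norm : X -> R^o) dB (normr0 _)). Qed.

Lemma EX_step (x : I -> X) : EX mu E (step B x).
Proof. by apply: (EX_simple mu E nE K); exact: simple_fun_step. Qed.

Variable phi : (T -> X) -> R.
Hypothesis dphi : dual_ball (EX mu (X:=X) E) (nEX (X:=X) nE) phi.

Let piece i (x : X) : T -> X := fun s => (\1_(B i) s : R) *: x.
Let phi_ i x := phi (piece i x).

Lemma EX_piece i x : EX mu E (piece i x).
Proof.
have [mB fBi] := fB i.
by apply: (EX_simple mu E nE K); exact: simple_fun_indic_cst.
Qed.

Lemma dual_pieceD i x y : phi_ i (x + y) = phi_ i x + phi_ i y.
Proof.
have [pD _ _] := dphi; rewrite /phi_ -pD; [|exact: EX_piece|exact: EX_piece].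
by congr phi; apply/funext => s; exact: scalerDr.
Qed.

Lemma dual_pieceZ i a x : phi_ i (a *: x) = a * phi_ i x.
Proof.
have [_ pZ _] := dphi; rewrite /phi_ -pZ; last exact: EX_piece.
by congr phi; apply/funext => s; rewrite /piece scalerA mulrC -scalerA.
Qed.

Lemma dual_piece_le i x : `|phi_ i x| <= nE (\1_(B i) : T -> R) * `|x|.
Proof.
have [_ _ pN] := dphi; apply: le_trans (pN _ (EX_piece i x)) _.
rewrite /nEX; have -> : (fun s => `|piece i x s|) = (fun s => `|x| * \1_(B i) s).
  by apply/funext => s; rewrite /piece normrZ mulrC ger0_norm// indicE.
have [mB fBi] := fB i.
rewrite (ideal_norm_homog _ _ _ K); last exact: (ideal_norm_indic _ _ _ K).
by rewrite normr_id mulrC.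
Qed.

Lemma dual_step x : phi (step B x) = \sum_i phi_ i (x i).
Proof.
have [pD pZ _] := dphi.
have -> : step B x = \sum_(i : I) piece i (x i).
  by apply/funext => s; rewrite fct_sumE.
have p0 : phi 0 = 0.
  rewrite -(scale0r (0 : T -> X)) pZ ?mul0r//.
  exact: (EX_simple mu E nE K _ (simple_fun0 mu)).
suff [] : EX mu E (\sum_(i : I) piece i (x i)) /\
    phi (\sum_(i : I) piece i (x i)) = \sum_i phi_ i (x i) by [].
elim: (index_enum I) => [|i r [Er pr]].
  rewrite !big_nil; split=> //; exact: (EX_simple mu E nE K _ (simple_fun0 mu)).
rewrite !big_cons; split; first exact: (EXD mu E nE K cmu _ _ (EX_piece _ _) Er).1.
by rewrite pD ?pr//; exact: EX_piece.
Qed.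

(* The dual norm of [phi_ i]. *)
Let a i := sup [set phi_ i x | x in [set x | `|x| <= 1]].

Lemma dual_piece_has_sup i : has_sup [set phi_ i x | x in [set x | `|x| <= 1]].
Proof.
split; first by exists (phi_ i 0), 0 => //=; rewrite normr0.
exists (nE (\1_(B i) : T -> R)) => _ [x /= x1 <-].
apply: le_trans (ler_norm _) (le_trans (dual_piece_le i x) _).
rewrite ler_piMr//; apply: (ideal_norm_ge0 mu E nE K).
by apply: (ideal_norm_indic _ _ _ K); have [] := fB i.
Qed.

Lemma dual_piece_ub i x : `|phi_ i x| <= a i * `|x|.
Proof.
wlog : x / 0 <= phi_ i x => [hw|p0].
  have [/hw//|p0] := leP 0 (phi_ i x).
  have := hw (- x); rewrite -scaleN1r dual_pieceZ mulN1r normrN scaleN1r normrN.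
  by apply; rewrite oppr_ge0 ltW.
rewrite ger0_norm//; have [->|x0] := eqVneq x 0.
  by rewrite -(scale0r (0 : X)) dual_pieceZ mul0r scale0r normr0 mulr0.
rewrite -ler_pdivrMr ?normr_gt0// mulrC -dual_pieceZ.
apply: sup_upper_bound; first exact: dual_piece_has_sup.
by exists (`|x|^-1 *: x) => //=; rewrite normrZ normfV normr_id mulVf ?normr_eq0.
Qed.

Lemma dual_piece_sup_ge0 i : 0 <= a i.
Proof.
apply: sup_upper_bound; first exact: dual_piece_has_sup.
exists 0; first by rewrite /= normr0.
by rewrite -(scale0r (0 : X)) dual_pieceZ mul0r.
Qed.

(** With [x i] in the unit ball almost norming [phi_ i], the sum is almost the value of [phi] at the
    step function with values [h i *: x i], whose norm is at most [q h]. *)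
Lemma dual_piece_sum_le h : (forall i, 0 <= h i) -> \sum_i a i * h i <= q h.
Proof.
move=> h0; apply/ler_addgt0Pr => e e0.
(* The total loss [eta * \sum_i h i] stays below [e]; the summand 1 keeps the denominator
   positive. *)
pose eta := e / (\sum_i h i + 1).
have S0 : 0 <= \sum_i h i by apply: sumr_ge0 => i _; exact: h0.
have eta0 : 0 < eta by rewrite divr_gt0//; lra.
have /choice[x hx] : forall i, exists x : X, `|x| <= 1 /\ a i - eta < phi_ i x.
  move=> i; have [_ [x /= x1 <-] hx] := sup_adherent eta0 (dual_piece_has_sup i).
  by exists x.
have le1 : \sum_i a i * h i <= phi (step B (fun i => h i *: x i)) + eta * \sum_i h i.
  rewrite dual_step mulr_sumr -big_split/=; apply: ler_sum => i _.
  rewrite dual_pieceZ [eta * _]mulrC -mulrDr mulrC ler_wpM2l//.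
  by have [_] := hx i; lra.
have le2 : phi (step B (fun i => h i *: x i)) <= q h.
  have [_ _ pN] := dphi; apply: le_trans (ler_norm _) (le_trans (pN _ (EX_step _)) _).
  rewrite nEX_step; apply: step_norm_le => i; rewrite normr_ge0 normrZ ger0_norm//.
  by rewrite ler_piMr//; have [] := hx i.
have le3 : eta * \sum_i h i <= e.
  by rewrite /eta -mulrA ger_pMr// ler_pdivrMl ?mulr1; lra.
by apply: le_trans le1 _; rewrite lerD.
Qed.

(** Nonnegative vectors suffice for the dual norm of [h |-> \sum_i a i * h i], because every [a i]
    is nonnegative. *)
Let norms := [set r | exists h : I -> R,
  [/\ forall i, 0 <= h i, q h <= 1 & r = \sum_i a i * h i]].

Let N := sup norms.

Lemma step_norms_has_sup : has_sup norms.
Proof.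
split.
  exists 0, (fun _ => 0); split => //; last by rewrite big1// => i _; rewrite mulr0.
  have -> : (fun _ : I => 0 : R) = (fun i => 0 * 0) by apply/funext => i; rewrite mul0r.
  by rewrite step_normZ normr0 mul0r.
exists 1 => _ [h [h0 q1 ->]]; exact: le_trans (dual_piece_sum_le h h0) q1.
Qed.

Lemma step_norms_sup_le1 : N <= 1.
Proof.
apply: ge_sup; first exact: step_norms_has_sup.1.
move=> _ [h [h0 q1 ->]]; exact: le_trans (dual_piece_sum_le h h0) q1.
Qed.

Lemma step_norms_sup_ge0 : 0 <= N.
Proof.
apply: sup_upper_bound; first exact: step_norms_has_sup.
exists (fun _ => 0); split => //; last by rewrite big1// => i _; rewrite mulr0.
have -> : (fun _ : I => 0 : R) = (fun i => 0 * 0) by apply/funext => i; rewrite mul0r.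
by rewrite step_normZ normr0 mul0r.
Qed.

Lemma dual_piece_sum_le_sup h : (forall i, 0 <= h i) -> \sum_i a i * h i <= N * q h.
Proof.
move=> h0; have [q0|q0] := eqVneq (q h) 0.
  (* A vector with [q h = 0] cannot be normalized, but there the bound with constant 1 is the same
     bound. *)
  by have := dual_piece_sum_le h h0; rewrite q0 mulr0.
have qp : 0 < q h by rewrite lt_neqAle eq_sym q0 step_norm_ge0.
rewrite -ler_pdivrMr//; apply: sup_upper_bound; first exact: step_norms_has_sup.
exists (fun i => (q h)^-1 * h i); split.
- by move=> i; rewrite mulr_ge0// invr_ge0 ltW.
- by rewrite step_normZ normfV gtr0_norm// mulVf.
- by rewrite mulr_suml; apply: eq_bigr => i _; rewrite -mulrA [h i * _]mulrC.
Qed.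

Variable (i0 : I).
Hypothesis qi0 : 0 < nE (\1_(B i0) : T -> R).

Lemma step_norming (eps : R) : 0 < eps -> exists c : I -> R,
  [/\ forall i, 0 <= c i, q c = 1 & (1 - eps) * N <= \sum_i a i * c i].
Proof.
move=> eps0; have [N0|N0] := eqVneq N 0.
  (* For [N = 0] any nonnegative vector of norm one works; the piece [B i0] of positive norm
     provides one. *)
  pose e i : R := (i == i0)%:R.
  have qe : q e = nE (\1_(B i0) : T -> R).
    rewrite /q; congr nE; apply/funext => s; rewrite /step (bigD1 i0)//= big1 ?addr0.
      by rewrite /e eqxx; exact: mulr1.
    by move=> i /negbTE ii0; rewrite /e ii0; exact: mulr0.
  exists (fun i => (q e)^-1 * e i); split.
  - by move=> i; rewrite mulr_ge0// ?ler0n// invr_ge0 qe ltW.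
  - by rewrite step_normZ normfV qe gtr0_norm// mulVf// gt_eqF.
  - rewrite N0 mulr0; apply: sumr_ge0 => i _; rewrite mulr_ge0 ?dual_piece_sup_ge0//.
    by rewrite mulr_ge0// ?ler0n// invr_ge0 qe ltW.
have Np : 0 < N by rewrite lt_neqAle eq_sym N0 step_norms_sup_ge0.
(* The cap [2^-1] keeps the value at [c] positive, hence [q c > 0]; rescaling [c] to norm one then
   only increases that value, as [q c <= 1]. *)
have eN : 0 < Num.min eps 2^-1 * N by rewrite mulr_gt0// lt_min eps0 invr_gt0 ltr0n.
have [_ [c [c0 qc ->]] hc] := sup_adherent eN step_norms_has_sup.
rewrite -/N in hc.
have m1 : Num.min eps 2^-1 <= eps by rewrite ge_min lexx.
have m2 : Num.min eps 2^-1 <= 2^-1 by rewrite ge_min lexx orbT.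
have p : 0 < \sum_i a i * c i.
  apply: le_lt_trans hc; rewrite subr_ge0 ger_pMl//; lra.
have qp : 0 < q c by apply: lt_le_trans p (dual_piece_sum_le c c0).
exists (fun i => (q c)^-1 * c i); split.
- by move=> i; rewrite mulr_ge0// invr_ge0 ltW.
- by rewrite step_normZ normfV gtr0_norm// mulVf// gt_eqF.
- have -> : \sum_i a i * ((q c)^-1 * c i) = (q c)^-1 * \sum_i a i * c i.
    by rewrite mulr_sumr; apply: eq_bigr => i _; rewrite mulrCA.
  apply: (@le_trans _ _ (\sum_i a i * c i)); last first.
    by apply: ler_peMl; [exact: ltW|rewrite invf_ge1].
  apply: le_trans (ltW hc); rewrite mulrBl mul1r lerD2l lerN2.
  by rewrite ler_wpM2r// ltW.
Qed.

(** One factor [1 - eps] is lost in [X], in the choice of each [y i], the other because [b] attains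
    [N] only up to [1 - eps]. *)
Lemma WOH_step (woh : WOH X) (n : nat) (z : 'I_n -> I -> X) (eps : R) :
  0 < eps -> eps < 1 ->
  exists y : T -> X, [/\ EX mu E y, nEX nE y = 1 &
    forall c : 'I_n -> R, (1 - eps) ^+ 2 * (`|phi (\sum_(j < n) c j *: step B (z j))| + 1)
      <= nEX nE (\sum_(j < n) c j *: step B (z j) + y)].
Proof.
move=> eps0 eps1.
have [b [b0 qb hb]] := step_norming eps eps0.
(* For [a i = 0] the quotient is 0 by convention, which loses nothing since [phi_ i] vanishes
   then. *)
have da i : dual_ball [set: X] (fun x : X => `|x|) (fun x => phi_ i x / a i).
  split.
  - by move=> x y _ _; rewrite dual_pieceD mulrDl.
  - by move=> r x _; rewrite dual_pieceZ mulrA.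
  - move=> x _; rewrite normrM normfV (ger0_norm (dual_piece_sup_ge0 i)).
    have [->|ai] := eqVneq (a i) 0; first by rewrite invr0 mulr0.
    have aip : 0 < a i by rewrite lt_neqAle eq_sym ai dual_piece_sup_ge0.
    by rewrite ler_pdivrMr// mulrC dual_piece_ub.
have /choice[y hy] : forall i, exists y : X, `|y| = 1 /\ forall c : 'I_n -> R,
    (1 - eps) * (`|phi_ i (\sum_(j < n) c j *: z j i) / a i| + 1) <=
    `|\sum_(j < n) c j *: z j i + y|.
  move=> i; have [y [_ y1 h]] := woh n (fun j => z j i) (fun _ => Logic.I) _ (da i) eps eps0.
  by exists y.
exists (step B (fun i => b i *: y i)); split; first exact: EX_step.
  rewrite nEX_step -[RHS]qb; congr q; apply/funext => i.
  by rewrite normrZ (hy i).1 mulr1 ger0_norm.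
move=> c; pose x i := \sum_(j < n) c j *: z j i.
have -> : \sum_(j < n) c j *: step B (z j) = step B x.
  apply/funext => s; rewrite fct_sumE /step /x.
  under [RHS]eq_bigr do rewrite scaler_sumr.
  rewrite exchange_big/=; apply: eq_bigr => j _.
  have -> : (c j *: (fun s0 => \sum_i (\1_(B i) s0 : R) *: z j i)) s =
    c j *: \sum_i (\1_(B i) s : R) *: z j i by [].
  by rewrite scaler_sumr; apply: eq_bigr => i _; rewrite !scalerA mulrC.
have -> : step B x + step B (fun i => b i *: y i) = step B (fun i => x i + b i *: y i).
  apply/funext => s; have -> : (step B x + step B (fun i => b i *: y i)) s =
    step B x s + step B (fun i => b i *: y i) s by [].
  by rewrite /step -big_split; apply: eq_bigr => i _; rewrite scalerDr.
(* Up to the factor [1 - eps], [w i] bounds the value of the sum on [B i] from below; weighted by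
   [a i], it splits into the parts from [phi] and from [b]. *)
pose w i := `|phi_ i (x i) / a i| + b i.
have w0 i : 0 <= w i by rewrite addr_ge0.
have lew i : (1 - eps) * w i <= `|x i + b i *: y i|.
  have [bi0|bi] := eqVneq (b i) 0.
    rewrite bi0 scale0r addr0 /w bi0 addr0.
    apply: (@le_trans _ _ `|phi_ i (x i) / a i|); first by rewrite ler_piMl//; lra.
    by have [_ _] := da i; apply.
  have bp : 0 < b i by rewrite lt_neqAle eq_sym bi b0.
  (* The subspace is invariant under scaling, so [y i] may be tested against [x i / b i];
     multiplying by [b i] gives the bound. *)
  have := (hy i).2 (fun j => (b i)^-1 * c j).
  have -> : \sum_(j < n) ((b i)^-1 * c j) *: z j i = (b i)^-1 *: x i.
    by rewrite scaler_sumr; apply: eq_bigr => j _; rewrite scalerA.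
  rewrite dual_pieceZ -mulrA normrM normfV (gtr0_norm bp) => h.
  have -> : x i + b i *: y i = b i *: ((b i)^-1 *: x i + y i).
    by rewrite scalerDr scalerA mulfV// scale1r.
  rewrite normrZ (gtr0_norm bp).
  apply: le_trans (ler_wpM2l (ltW bp) h); rewrite /w.
  by rewrite mulrCA [b i * (_ + _)]mulrDr mulrA mulfV// mul1r mulr1.
have qw : (1 - eps) * q w <= nEX nE (step B (fun i => x i + b i *: y i)).
  have <- : q (fun i => (1 - eps) * w i) = (1 - eps) * q w.
    by rewrite step_normZ ger0_norm// subr_ge0 ltW.
  rewrite nEX_step; apply: step_norm_le => i; rewrite lew andbT mulr_ge0//; lra.
apply: le_trans qw; rewrite expr2 -mulrA.
apply: ler_wpM2l; first lra.
have aw i : a i * w i = `|phi_ i (x i)| + a i * b i.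
  rewrite mulrDr normrM normfV (ger0_norm (dual_piece_sup_ge0 i)).
  have [ai|ai] := eqVneq (a i) 0; last by rewrite mulrCA mulfV// mulr1.
  by have := dual_piece_ub i (x i); rewrite ai !mul0r normr_le0 => /eqP ->; rewrite normr0.
have Saw : \sum_i a i * w i = \sum_i `|phi_ i (x i)| + \sum_i a i * b i.
  by rewrite -big_split; apply: eq_bigr => i _; exact: aw.
have pf : `|phi (step B x)| <= \sum_i `|phi_ i (x i)|.
  by rewrite dual_step; exact: ler_norm_sum.
have [N0|N0] := eqVneq N 0.
  (* For [N = 0] the functional vanishes on the step functions, and it remains to see that [q w] is
     at least [q b = 1]. *)
  have /eqP -> : `|phi (step B x)| == 0.
    rewrite eq_le normr_ge0 andbT.
    apply: le_trans pf _.
    have := dual_piece_sum_le_sup (fun i => `|x i|) (fun i => normr_ge0 _).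
    rewrite N0 mul0r; apply: le_trans; apply: ler_sum => i _; exact: dual_piece_ub.
  have : q b <= q w by apply: step_norm_le => i; rewrite b0 /w lerDr normr_ge0.
  rewrite qb; lra.
have Np : 0 < N by rewrite lt_neqAle eq_sym N0 step_norms_sup_ge0.
have := dual_piece_sum_le_sup w w0; rewrite Saw => h1.
have N1 := step_norms_sup_le1.
have p0 := normr_ge0 (phi (step B x)).
(* After multiplication by [N], the sum with weights [a i] is a lower bound for [N * q w]; the term
   in [phi] fits because [N <= 1]. *)
suff : N * ((1 - eps) * (`|phi (step B x)| + 1)) <= N * q w by rewrite ler_pM2l.
apply: le_trans h1.
apply: le_trans (lerD pf hb).
have : N * `|phi (step B x)| <= `|phi (step B x)| by rewrite ler_piMl.
have := mulr_ge0 (mulr_ge0 (ltW Np) p0) (ltW eps0).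
nra.
Qed.

End WOH_step.

(** * From step functions to arbitrary finite-dimensional subspaces *)

Section WOH_transfer.
Context {R : realType} {d : measure_display} {T : measurableType d}.
Variables (mu : {measure set T -> \bar R}) (E : set (T -> R)) (nE : (T -> R) -> R).
Hypotheses (K : ideal_norm mu E nE) (cmu : measure_is_complete mu).
Variables (A : set T) (mA : measurable A) (muA : (0 < mu A)%E) (fA : (mu A < +oo)%E).
Context {X : normedModType R}.

(** Otherwise the triangle inequality would bound the norm by a sum of zeros. *)
Lemma step_piece_norm_gt0 {I : finType} (B : I -> set T) (z : I -> X) :
  finite_sets mu B -> 0 < nEX nE (step B z) -> exists i, 0 < nE (\1_(B i) : T -> R).
Proof.
move=> fB zpos; apply: contrapT => nB.
have n0 i : nE (\1_(B i) : T -> R) = 0.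
  apply/eqP; rewrite eq_le; apply/andP; split.
    by rewrite leNgt; apply/negP => h; apply: nB; exists i.
  apply: (ideal_norm_ge0 mu E nE K); have [mB fBi] := fB i.
  exact: (ideal_norm_indic _ _ _ K).
pose g i : T -> X := fun s => (\1_(B i) s : R) *: z i.
have Eg i : EX mu E (g i).
  have [mB fBi] := fB i.
  by apply: (EX_simple mu E nE K); exact: simple_fun_indic_cst.
have ng i : nEX nE (g i) = 0.
  rewrite /nEX; have -> : (fun s => `|g i s|) = (fun s => `|z i| * \1_(B i) s).
    by apply/funext => s; rewrite /g normrZ mulrC ger0_norm// indicE.
  have [mB fBi] := fB i.
  rewrite (ideal_norm_homog _ _ _ K); last exact: (ideal_norm_indic _ _ _ K).
  by rewrite n0 mulr0.
have := nEX_sum mu E nE K cmu (index_enum I) (fun _ => 1) g A mA fA Eg.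
have -> : \sum_(j <- index_enum I) (1 : R) *: g j = step B z.
  by apply/funext => s; rewrite fct_sumE; apply: eq_bigr => i _; rewrite scale1r.
by rewrite [leRHS]big1 ?leNgt ?zpos// => i _; rewrite ng mulr0.
Qed.

(** For combinations of large norm the triangle inequality is enough. The others have a
    representative with bounded coefficients, so replacing each [u j] by a simple function costs a
    uniformly small error, both in the norm and in [phi]. *)
Lemma WOH_EX : simple_dense mu X E nE -> WOH X ->
  WOH_on (EX mu (X:=X) E) (nEX (X:=X) nE).
Proof.
move=> dense woh n u Eu phi dphi eps eps0.
pose e := Num.min eps 2^-1.
have e0 : 0 < e by rewrite lt_min eps0 invr_gt0 ltr0n.
have e2 : e <= 2^-1 by rewrite ge_min lexx orbT.
have eeps : e <= eps by rewrite ge_min lexx.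
pose F (c : 'I_n -> R) : T -> X := \sum_(j < n) c j *: u j.
have EF c : EX mu E (F c) by exact: (EX_sum mu E nE K cmu _ _ _ A).
pose q (c : 'rV[R]_n) := nEX nE (F (c ord0)).
have FB (c c' : 'I_n -> R) : F c - F c' = F (fun j => c j - c' j).
  by rewrite /F -sumrB; apply: eq_bigr => j _; rewrite scalerBl.
have [||C C0 HC] := seminorm_rV_bounded_rep q.
- move=> c c'; rewrite /q; have -> : F ((c + c') ord0) = F (c ord0) + F (c' ord0).
    by rewrite /F -big_split; apply: eq_bigr => j _; rewrite mxE scalerDl.
  exact: (EXD mu E nE K cmu _ _ (EF _) (EF _)).2.
- move=> a c; rewrite /q; have -> : F ((a *: c) ord0) = a *: F (c ord0).
    by rewrite /F scaler_sumr; apply: eq_bigr => j _; rewrite mxE scalerA.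
  exact: (EXZ mu E nE K a _ (EF _)).2.
(* From norm [M] on, subtracting 1 from the norm of [F c] leaves at least [1 - e] times that norm
   plus 1. *)
pose M := 2 / e.
have M0 : 0 < M by rewrite divr_gt0.
(* The losses are [2 * eta] in the factor [(1 - eta) ^+ 2], one [eta] in [phi] and one in the norm,
   well within [e]. In [delta], the [n] coefficients are each at most [C * M]. *)
pose eta := e / 8.
have eta0 : 0 < eta by rewrite divr_gt0.
pose delta := eta / (n%:R * (C * M) + 1).
have nCM : 0 <= n%:R * (C * M) by rewrite mulr_ge0// mulr_ge0// ltW.
have delta0 : 0 < delta by rewrite divr_gt0//; lra.
(* The zero subspace and the zero functional yield a unit vector of [X]. *)
have [z [_ z1 _]] : exists z, [/\ [set: X] z, `|z| = 1 & forall c : 'I_0 -> R,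
    (1 - 1) * (`|(fun _ : X => 0 : R) (\sum_(i < 0) c i *: 0)| + 1)
       <= `|\sum_(i < 0) c i *: (0 : X) + z|].
  apply: (woh 0%N (fun _ => 0) (fun _ => Logic.I) (fun _ => 0)) => //.
  by split => // [x y _ _|a x _|x _]; rewrite ?addr0 ?mulr0 ?normr0.
have [v [sv Ev v1]] := EX_unit_indic mu E nE K A mA muA fA z z1.
have /choice[g hg] : forall j, exists g, simple_fun mu g /\ nEX nE (u j \- g) < delta.
  by move=> j; exact: dense.
(* The norm-one function [v] is refined together with the [g j], so that the partition has a piece
   of positive norm. *)
have sG (o : option 'I_n) : simple_fun mu (if o is Some j then g j else v).
  by case: o => // j; have [] := hg j.
have [I [B [w [fB dB wG]]]] := simple_fun_refine mu _ sG.
have [i0 Bi0] : exists i, 0 < nE (\1_(B i) : T -> R).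
  apply: (step_piece_norm_gt0 B (w None)) => //.
  by have := wG None => /= <-; rewrite v1.
have [|y [Ey y1 hy]] := WOH_step mu E nE K cmu B fB dB phi dphi i0 Bi0 woh n
  (fun j => w (Some j)) eta eta0.
  by rewrite /eta; lra.
exists y; split => // c; rewrite -/(F c).
have [pD pZ pN] := dphi.
have Efy := (EXD mu E nE K cmu _ _ (EF c) Ey).1.
have pF0 := normr_ge0 (phi (F c)).
apply: (@le_trans _ _ ((1 - e) * (`|phi (F c)| + 1))).
  by rewrite ler_wpM2r//; lra.
have [big|small] := leP M (nEX nE (F c)).
  have := nEX_lipschitz mu E nE K cmu _ _ (EF c) Efy.
  have -> : F c - (F c + y) = - y by rewrite opprD addrA subrr add0r.
  rewrite (nEXN mu E nE K)// y1 => h.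
  have := pN _ (EF c) => h1.
  have h2 : 2 <= e * nEX nE (F c) by rewrite mulrC -ler_pdivrMr.
  apply: (@le_trans _ _ ((1 - e) * (nEX nE (F c) + 1))); last lra.
  by rewrite ler_wpM2l//; lra.
have [c' cc' c'le] := HC (\row_j c j).
have qc : q (\row_j c j) = nEX nE (F c).
  by rewrite /q; congr (nEX nE (F _)); apply/funext => j; rewrite mxE.
have {}cc' : nEX nE (F c - F (c' ord0)) = 0.
  rewrite FB -cc' /q; congr (nEX nE (F _)); apply/funext => j.
  by rewrite !mxE.
pose G : T -> X := \sum_(j < n) c' ord0 j *: g j.
have Eg j : EX mu E (g j) by apply: (EX_simple mu E nE K); have [] := hg j.
have EG : EX mu E G by exact: (EX_sum mu E nE K cmu _ _ _ A).
have Gle : nEX nE (F (c' ord0) - G) <= eta.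
  have -> : F (c' ord0) - G = \sum_(j < n) c' ord0 j *: (u j - g j).
    by rewrite /F /G -sumrB; apply: eq_bigr => j _; rewrite scalerBr.
  apply: le_trans (nEX_sum mu E nE K cmu _ _ _ A mA fA _) _.
    by move=> j; exact: (EXB mu E nE K cmu).
  apply: (@le_trans _ _ (\sum_(j < n) (C * M) * delta)).
    apply: ler_sum => j _; apply: ler_pM => //.
    - by apply: (nEX_ge0 mu E nE K); exact: (EXB mu E nE K cmu).
    - apply: le_trans (le_norm_rV _ _) (le_trans c'le _).
      by rewrite ler_wpM2l// qc ltW.
    - by apply: ltW; have [_] := hg j.
  rewrite sumr_const card_ord -mulr_natl mulrA /delta mulrCA ger_pMr//.
  by rewrite ler_pdivrMr; lra.
have fG : nEX nE (F c - G) <= eta.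
  have := (EXD mu E nE K cmu _ _ (EXB mu E nE K cmu _ _ (EF c) (EF (c' ord0)))
    (EXB mu E nE K cmu _ _ (EF (c' ord0)) EG)).2.
  by rewrite addrA subrK; lra.
have EFG := EXB mu E nE K cmu _ _ (EF c) EG.
have phiFG : `|phi (F c)| <= `|phi G| + eta.
  have -> : phi (F c) = phi G + phi (F c - G) by rewrite -pD// addrC subrK.
  apply: le_trans (ler_normD _ _) _; rewrite lerD2l.
  exact: le_trans (pN _ EFG) fG.
have EGy := (EXD mu E nE K cmu _ _ EG Ey).1.
have := nEX_lipschitz mu E nE K cmu _ _ EGy Efy.
have -> : G + y - (F c + y) = G - F c by rewrite opprD addrACA subrr addr0.
rewrite (nEXBC mu E nE K cmu)// => h1.
have := hy (c' ord0).
have -> : \sum_(j < n) c' ord0 j *: step B (w (Some j)) = G.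
  by apply: eq_bigr => j _; have := wG (Some j) => /= ->.
move=> h2.
have h3 : (1 - 2 * eta) * (`|phi G| + 1) <= (1 - eta) ^+ 2 * (`|phi G| + 1).
  apply: ler_wpM2r; first by rewrite addr_ge0.
  have := mulr_ge0 (ltW eta0) (ltW eta0); nra.
have h4 : (1 - 2 * eta) * (`|phi (F c)| - eta + 1) <= (1 - 2 * eta) * (`|phi G| + 1).
  by apply: ler_wpM2l; [rewrite /eta; lra|lra].
have h5 := mulr_ge0 (ltW e0) pF0.
have h6 := mulr_ge0 (ltW eta0) (ltW eta0).
have e8 : e = 8 * eta by rewrite /eta; lra.
rewrite e8 in h5 *; nra.
Qed.

End WOH_transfer.

(** * Lebesgue-Bochner spaces *)

Section Lp.
Context {R : realType} {d : measure_display} {T : measurableType d}.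
Variable mu : {measure set T -> \bar R}.

Definition Lp_fun (p : \bar R) : set (T -> R) :=
  fun f => measurable_fun [set: T] f /\ (Lnorm mu p (EFin \o f) < +oo)%E.

Definition Lp_norm (p : \bar R) (f : T -> R) : R := fine (Lnorm mu p (EFin \o f)).

Lemma measurable_powR_normr (f : T -> R) (r : R) : measurable_fun [set: T] f ->
  measurable_fun [set: T] (fun s => ((`|f s| `^ r)%:E : \bar R)).
Proof.
move=> mf; apply/measurable_EFinP.
apply: (@measurableT_comp _ _ _ _ _ _ (@powR R ^~ r)) => //.
exact: measurableT_comp.
Qed.

Lemma Lp_fun_fin p f : Lp_fun p f -> Lnorm mu p (EFin \o f) = (Lp_norm p f)%:E.
Proof. by move=> [_ ff]; rewrite /Lp_norm fineK// ge0_fin_numE// Lnorm_ge0. Qed.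

Lemma Lnorm_le_ae (p : \bar R) (f g : T -> R) : (1 <= p)%E ->
  measurable_fun [set: T] f -> measurable_fun [set: T] g ->
  {ae mu, forall s, `|g s| <= `|f s|} ->
  (Lnorm mu p (EFin \o g) <= Lnorm mu p (EFin \o f))%E.
Proof.
move=> p1 mf mg gf; rewrite unlock /Lnorm; case: p p1 => [r r1||//].
  rewrite lee_fin in r1.
  have r0 : 0 <= r by lra.
  apply: gt0_ler_poweR; first by rewrite invr_ge0.
  - by rewrite in_itv/= leey andbT; apply: integral_ge0 => s _; rewrite /= lee_fin powR_ge0.
  - by rewrite in_itv/= leey andbT; apply: integral_ge0 => s _; rewrite /= lee_fin powR_ge0.
  apply: ae_ge0_le_integral => //.
  - by move=> s _; rewrite lee_fin powR_ge0.
  - exact: measurable_powR_normr.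
  - by move=> s _; rewrite lee_fin powR_ge0.
  - exact: measurable_powR_normr.
  - apply: filterS gf => s gfs _; rewrite /= lee_fin.
    by apply: ge0_ler_powR => //; rewrite nnegrE.
(* At [+oo] the norm is an essential supremum, with value 0 by convention on a null space. *)
move=> _; case: ifPn => // _; apply: le_ess_sup.
by apply: filterS gf => s; rewrite /= lee_fin.
Qed.

Lemma Lnorm_indic_lty (p : \bar R) (A : set T) : (1 <= p)%E -> measurable A ->
  (mu A < +oo)%E -> (Lnorm mu p (EFin \o (\1_A : T -> R)) < +oo)%E.
Proof.
move=> p1 mA fA; rewrite unlock /Lnorm; case: p p1 => [r r1||//].
  rewrite lee_fin in r1; apply: poweR_lty.
  rewrite (_ : (\int[mu]_x _)%E = (\int[mu]_x (\1_A x)%:E)%E).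
    by rewrite integral_indic// setIT.
  apply: eq_integral => s _; rewrite /= indicE; congr EFin.
  by case: (s \in A); rewrite ?normr1 ?powR1// normr0 powR0// gt_eqF//; lra.
move=> _; case: ifPn => // _; apply: (@le_lt_trans _ _ 1%E); last exact: ltry.
apply/ess_supP; apply: aeW => s; rewrite /= lee_fin indicE.
by case: (s \in A); rewrite ?normr1 ?normr0.
Qed.

Lemma Lnorm_scale (p : \bar R) (a : R) (f : T -> R) : (1 <= p)%E ->
  measurable_fun [set: T] f ->
  Lnorm mu p (EFin \o (fun s => a * f s)) = (`|a|%:E * Lnorm mu p (EFin \o f))%E.
Proof.
move=> + mf; rewrite unlock /Lnorm; case: p => [r r1||//].
  rewrite lee_fin in r1; have r0 : r != 0 by rewrite gt_eqF//; lra.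
  under eq_integral do rewrite /= normrM powRM// EFinM.
  rewrite ge0_integralZl_EFin ?powR_ge0//; last exact: measurable_powR_normr.
  rewrite poweRM; last 2 first.
  - by rewrite lee_fin powR_ge0.
  - by apply: integral_ge0 => s _; rewrite lee_fin powR_ge0.
  by rewrite poweR_EFin -powRrM mulfV// powRr1.
move=> _; case: ifPn => mu0; last by rewrite mule0.
rewrite -ess_supZl//; apply/eq_ess_sup/nearW => s /=.
by rewrite normrM EFinM.
Qed.

(** The triangle inequality is Minkowski's, and indicators have positive norm because the norm
    vanishes only on a.e. null functions. *)
Lemma Lp_ideal_norm (p : \bar R) : (1 <= p)%E -> ideal_norm mu (Lp_fun p) (Lp_norm p).
Proof.
move=> p1.
have ideal (f g : T -> R) : Lp_fun p f -> measurable_fun [set: T] g ->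
    {ae mu, forall s, `|g s| <= `|f s|} -> Lp_fun p g /\ Lp_norm p g <= Lp_norm p f.
  move=> Lf mg gf; have [mf ff] := Lf.
  have le := Lnorm_le_ae p f g p1 mf mg gf.
  have Lg : Lp_fun p g by split => //; exact: le_lt_trans ff.
  by split=> //; rewrite -lee_fin -!Lp_fun_fin.
have Dle f g : Lp_fun p f -> Lp_fun p g -> Lp_fun p (f \+ g) /\
    Lp_norm p (f \+ g) <= Lp_norm p f + Lp_norm p g.
  move=> Lf Lg; have [mf ff] := Lf; have [mg fg] := Lg.
  have h := eminkowski mu mf mg p1.
  have Lfg : Lp_fun p (f \+ g).
    split; first exact: measurable_funD.
    by apply: (le_lt_trans h); exact: lte_add_pinfty.
  by split => //; rewrite -lee_fin EFinD -!Lp_fun_fin.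
have Zeq (a : R) f : Lp_fun p f -> Lp_fun p (fun s => a * f s) /\
    Lp_norm p (fun s => a * f s) = `|a| * Lp_norm p f.
  move=> Lf; have [mf ff] := Lf; rewrite /Lp_norm Lnorm_scale// fineM//; last first.
    by rewrite Lp_fun_fin.
  split=> //; split; first exact: measurable_funM.
  by rewrite Lnorm_scale// Lp_fun_fin// -EFinM ltry.
split=> //.
- by move=> f [].
- by move=> f g Lf Lg; have [] := Dle f g Lf Lg.
- by move=> a f Lf; have [] := Zeq a f Lf.
- by move=> f g Lf Lg; have [] := Dle f g Lf Lg.
- by move=> a f Lf; have [] := Zeq a f Lf.
- by move=> A mA fA; split; [exact: measurable_indic|exact: Lnorm_indic_lty].
- move=> A mA muA fA.
  have LA : Lp_fun p (\1_A : T -> R).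
    by split; [exact: measurable_indic|exact: Lnorm_indic_lty].
  rewrite -lte_fin -Lp_fun_fin// lt0e Lnorm_ge0 andbT; apply/eqP => N0.
  have [||N [mN muN AN]] := Lnorm_eq0_eq0 _ _ N0.
  - by apply/measurable_EFinP; exact: measurable_indic.
  - exact: lt_le_trans p1.
  have : (mu A <= mu N)%E.
    apply: le_measure; rewrite ?inE// => s As; apply: AN => /= /(_ Logic.I).
    by rewrite indicE mem_set// => /eqP; rewrite onee_eq0.
  by rewrite muN leNgt muA.
Qed.

Hypothesis cmu : measure_is_complete mu.
Context {X : normedModType R}.

(** A countably valued [h] is close to [f] in norm, and its simple truncations [g n] converge to [h]
    in norm by dominated convergence. *)
Lemma Lp_simple_dense (p : R) : 1 <= p ->
  simple_dense mu X (Lp_fun p%:E) (Lp_norm p%:E).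
Proof.
move=> p1 f Ef eps eps0; have [bf Lf] := Ef.
have p1' : (1 <= p%:E)%E by rewrite lee_fin.
have K := Lp_ideal_norm _ p1'.
set nE := Lp_norm p%:E in K *.
have nf0 := nEX_ge0 mu _ _ K f Ef.
(* This makes the distance from [f] to [h] at most [eps / 4], leaving [eps / 2] for the
   truncation. *)
pose delta := eps / (4 * (nEX nE f + 1)).
have delta0 : 0 < delta by rewrite divr_gt0// mulr_gt0//; lra.
have [h [g [sg gh gh0 fh]]] := bochner_measurable_approx mu cmu f delta bf delta0.
have bh : bochner_measurable mu h.
  exists g; split => //; apply: aeW => s; have [N hN] := gh s.
  by apply: cvg_near_cst; exists N => // n /= Nn; exact/hN.
have bB (u v : T -> X) : bochner_measurable mu u -> bochner_measurable mu v ->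
    bochner_measurable mu (u - v).
  move=> bu bv; rewrite -scaleN1r; apply: bochner_measurableD => //.
  exact: bochner_measurableZ.
have [Efh nfh] : EX mu (Lp_fun p%:E) (f - h) /\ nEX nE (f - h) <= delta * nEX nE f.
  have Edf := ideal_norm_scale _ _ _ K delta _ Lf.
  have := EX_dominated mu _ _ K cmu (f - h) _ (bB _ _ bf bh) Edf fh.
  by rewrite (ideal_norm_homog _ _ _ K)// (gtr0_norm delta0).
have Eh : EX mu (Lp_fun p%:E) h.
  have := EXB mu _ _ K cmu _ _ Ef Efh; by rewrite opprB addrC subrK.
have p0 : 0 < p by lra.
have pN0 : p != 0 by rewrite gt_eqF.
have mh : measurable_fun [set: T] (fun s => `|h s|) := bochner_measurable_normr mu cmu h bh.
have ih : mu.-integrable [set: T] (fun s => (`| `|h s| | `^ p)%:E).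
  apply/integrableP; split; first exact: measurable_powR_normr.
  have [_ [_ hfin]] := Eh.
  rewrite (_ : (\int[mu]_x _)%E = (Lnorm mu p%:E (EFin \o (fun s => `|h s|%R)) `^ p)%E).
    exact: poweR_lty.
  rewrite poweR_Lnorm//; apply: eq_integral => s _.
  by rewrite gee0_abs// lee_fin powR_ge0.
have Eg n : EX mu (Lp_fun p%:E) (g n) := EX_simple mu _ _ K (g n) (sg n).
have Ehg n := EXB mu _ _ K cmu _ _ Eh (Eg n).
have mhg n : measurable_fun [set: T] (fun s => `|(h - g n) s|).
  by apply: (bochner_measurable_normr mu cmu); case: (Ehg n).
pose D n s : R := `| `|(h - g n) s| | `^ p.
have D0 s : \forall n \near \oo, (D n s)%:E = 0%E.
  have [N hN] := gh s; exists N => // n /= Nn; rewrite /D.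
  by have -> : (h - g n) s = h s - g n s by []; rewrite (hN _ Nn) subrr !normr0 powR0.
(* Each [g n s] is [h s] or 0, so [|h s|] to the power [p] dominates. *)
have Dh s n : (`| (D n s)%:E | <= (`| `|h s| | `^ p)%:E)%E.
  rewrite abse_EFin lee_fin ger0_norm ?powR_ge0// /D.
  have -> : (h - g n) s = h s - g n s by [].
  have [->|->] := gh0 n s; last by rewrite subr0.
  by rewrite subrr !normr0 powR0// powR_ge0.
have [_ _] := @dominated_convergence _ _ _ mu _ measurableT
  (fun n s => (D n s)%:E) (fun _ => 0%E) _
  (fun n => measurable_powR_normr _ p (mhg n)) (measurable_cst _)
  (aeW _ (fun s _ => cvg_near_cst _ (D0 s))) ih
  (aeW _ (fun s n _ => Dh s n)).
rewrite integral0 => cv.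
have r0 : (0 < ((eps / 2) `^ p)%:E)%E by rewrite lte_fin; apply: powR_gt0; lra.
have [n _ /(_ n (leqnn n)) /= hn] := cv _ (open_ereal_lt' r0).
exists (g n); split=> //.
have hgn : nEX nE (h - g n) < eps / 2.
  rewrite -lte_fin /nEX /nE -Lp_fun_fin; last by case: (Ehg n).
  rewrite ltNge; apply/negP => hle.
  move: hn; apply/negP; rewrite -leNgt.
  rewrite [leRHS](_ : _ = (Lnorm mu p%:E (EFin \o (fun s => `|(h - g n) s|%R)) `^ p)%E).
    rewrite -poweR_EFin; apply: gt0_ler_poweR => //; first exact: ltW.
    - by rewrite in_itv/= leey andbT lee_fin divr_ge0// ltW.
    - by rewrite in_itv/= leey andbT Lnorm_ge0.
  by rewrite poweR_Lnorm.
have := (EXD mu _ _ K cmu _ _ Efh (Ehg n)).2.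
rewrite addrA subrK => hle; apply: (le_lt_trans hle).
have : delta * nEX nE f <= eps / 4.
  rewrite /delta -mulrA ler_pM2l// ler_pdivrMl; last by rewrite mulr_gt0//; lra.
  lra.
lra.
Qed.

End Lp.

(** Completeness of [mu] makes the norm of a Bochner-measurable function measurable, which [Lp_fun]
    asks for explicitly. *)
Lemma LpX_EX {R : realType} {d : measure_display} {T : measurableType d}
    (mu : {measure set T -> \bar R}) (X : normedModType R) (p : \bar R) :
  measure_is_complete mu -> LpX mu (X:=X) p = EX mu (X:=X) (Lp_fun mu p).
Proof.
move=> cmu; apply/seteqP; split => [f [bf ff]|f [bf [_ ff]]]; split => //.
by split => //; exact: (bochner_measurable_normr mu cmu).
Qed.

(** Positivity of [mu [set: T]] excludes the zero function space, which has no unit vectors. *)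
Theorem theorem4p1 (R : realType) (d : measure_display) (T : measurableType d)
    (mu : {measure set T -> \bar R}) (X : completeNormedModType R) :
  measure_is_complete mu -> sigma_finite [set: T] mu -> (0 < mu [set: T])%E ->
  [/\ forall (E : set (T -> R)) (nE : (T -> R) -> R),
        is_Kothe mu E nE -> simple_dense mu X E nE ->
        (LOH X -> LOH_on (EX mu (X:=X) E) (nEX (X:=X) nE)) /\
        (WOH X -> WOH_on (EX mu (X:=X) E) (nEX (X:=X) nE)),
      forall p : R, 1 <= p ->
        (LOH X -> LOH_on (LpX mu (X:=X) p%:E) (LpnX mu (X:=X) p%:E)) /\
        (WOH X -> WOH_on (LpX mu (X:=X) p%:E) (LpnX mu (X:=X) p%:E)) &
      LOH X -> LOH_on (LpX mu (X:=X) +oo%E) (LpnX mu (X:=X) +oo%E)].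
Proof.
move=> cmu sfmu muT.
have [A [mA muA fA]] := sigma_finite_pos_set mu sfmu muT.
split.
- move=> E nE /Kothe_ideal_norm K dense; split.
    exact: (LOH_EX mu E nE K cmu A).
  exact: (WOH_EX mu E nE K cmu A).
- move=> p p1; have p1' : (1 <= p%:E)%E by rewrite lee_fin.
  have K := Lp_ideal_norm mu _ p1'; rewrite LpX_EX//; split.
    exact: (LOH_EX mu _ _ K cmu A).
  by apply: (WOH_EX mu _ _ K cmu A) => //; exact: Lp_simple_dense.
- have K := Lp_ideal_norm mu +oo%E (leey _); rewrite LpX_EX//.
  exact: (LOH_EX mu _ _ K cmu A).
Qed.
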